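(* Let $\theta$ be an inner function and $g \in L^\infty(\mathbb{T})$. If $n$ is the greatest natural number such that $\ker A_g^\theta \subseteq z^nH^2$, then $\frac{\ker A_g^\theta}{z^n}$ is a nearly $S^*$-invariant subspace.
   Context: $H^2$ is the Hardy space of the unit disc, identified with its boundary functions in $L^2=L^2(\mathbb{T})$; $\overline{H^2_0} = \{\overline f : f\in H^2, f(0)=0\}$. For an inner function $\theta$, $K_\theta = \theta\overline{H^2_0}\cap H^2$ and $P_\theta:L^2\to K_\theta$ is the orthogonal projection. For $g\in L^\infty$, the truncated Toeplitz operator $A_g^\theta : K_\theta\to K_\theta$ is $A_g^\theta(f)=P_\theta(gf)$. The backward shift is $S^*f(z)=(f(z)-f(0))/z$. A closed subspace $M\subseteq H^2$ is nearly $S^*$-invariant if $S^*f\in M$ whenever $f\in M$ and $f(0)=0$. $\frac{\ker A_g^\theta}{z^n}=\{f/z^n : f\in\ker A_g^\theta\}$. *)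

(* Defs.v *)
From HB Require Import structures.
From mathcomp Require Import all_boot all_order all_algebra.
From mathcomp Require Import complex.
From mathcomp Require Import all_classical all_reals all_analysis.

Set Implicit Arguments.
Unset Strict Implicit.
Unset Printing Implicit Defensive.

Import Order.TTheory GRing.Theory Num.Theory.
Import numFieldNormedType.Exports.

Local Open Scope classical_set_scope.
Local Open Scope ring_scope.
Local Open Scope complex_scope.

(* The unit circle is parametrized by t |-> e^{it} on [0, 2pi]: a function on
   the circle is a map R -> R[i] of the parameter, considered up to equality
   almost everywhere for [circle_measure]; its values off [0, 2pi] are
   irrelevant since that measure is carried by [0, 2pi]. *)

Lemma zero_lt_2pi (R : realType) : 0 < pi *+ 2 :> R.
Proof. by rewrite mulrn_wgt0 // pi_gt0. Qed.

Definition circle_measure (R : realType) : probability (measurableTypeR R) R :=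
  uniform_prob (zero_lt_2pi R).

Section HardySpace.
Context (R : realType).

Local Notation m := (circle_measure R).
Local Notation C := R[i].
Local Notation circle_fun := (R -> C).
Local Notation normc := Normc.normc.

Definition eit (t : R) : C := cos t +i* sin t.

Definition circle_int (f : circle_fun) : C :=
  (\int[m]_t complex.Re (f t))%R +i* (\int[m]_t complex.Im (f t))%R.

Definition norm_Lp (p : \bar R) (f : circle_fun) : \bar R :=
  ('N[m]_p[(fun t => (normc (f t))%:E)])%E.

Definition Lp (p : \bar R) : set circle_fun :=
  [set f | [/\ measurable_fun setT (fun t : measurableTypeR R => complex.Re (f t)),
               measurable_fun setT (fun t : measurableTypeR R => complex.Im (f t)) &
               (norm_Lp p f < +oo)%E]].

Definition L2 : set circle_fun := Lp 2%:E.
Definition Linfty : set circle_fun := Lp +oo%E.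

Definition inner_prod (f g : circle_fun) : C :=
  circle_int (fun t => f t * (g t)^*%C).

(* The Hardy space of the open unit disc: power series with square-summable
   Taylor coefficients.  Values of F off the open disc are irrelevant. *)
Definition hardy_disc (F : C -> C) : Prop :=
  exists a : nat -> C,
    cvgn (series (fun k => normc (a k) ^+ 2)) /\
    forall w : C, normc w < 1 ->
      (fun N : nat => normc (F w - \sum_(k < N) a k * w ^+ k)) @ \oo --> (0 : R).

(* f is the boundary function of F: the dilates t |-> F (r e^{it}) tend to f
   in L2 as r tends to 1 from below. *)
Definition boundary_fun (F : C -> C) (f : circle_fun) : Prop :=
  L2 f /\
  norm_Lp 2%:E (fun t => F (r%:C * eit t) - f t) @[r --> (1 : R)^'-] --> 0%E.

Definition H2 : set circle_fun :=
  [set f | exists F : C -> C, hardy_disc F /\ boundary_fun F f].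

(* For f in H2, the holomorphic function on the open disc whose boundary
   function is f; it is unique on the disc. *)
Definition disc_ext (f : circle_fun) : C -> C :=
  xget (fun=> 0) [set F : C -> C | hardy_disc F /\ boundary_fun F f].

(* phi M, as a set of classes modulo equality almost everywhere. *)
Definition mul_set (phi : circle_fun) (M : set circle_fun) : set circle_fun :=
  [set f | L2 f /\ exists2 h, M h & {ae m, forall t, f t = phi t * h t}].

Definition conj_H20 : set circle_fun :=
  [set f | exists2 h, H2 h /\ disc_ext h 0 = 0 & f = (fun t => (h t)^*)].

Definition inner_function (theta : circle_fun) : Prop :=
  [/\ H2 theta,
      (exists B : R, forall w : C, normc w < 1 ->
         normc (disc_ext theta w) <= B) &
      {ae m, forall t, normc (theta t) = 1}].

Definition model_space (theta : circle_fun) : set circle_fun :=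
  mul_set theta conj_H20 `&` H2.

(* The orthogonal projection of L2 onto M, defined up to equality almost
   everywhere (the default value is irrelevant for a closed subspace M). *)
Definition orth_proj (M : set circle_fun) (f : circle_fun) : circle_fun :=
  xget (fun=> 0)
    [set h | M h /\ forall k, M k -> inner_prod (fun t => f t - h t) k = 0].

Definition truncated_toeplitz (theta g f : circle_fun) : circle_fun :=
  orth_proj (model_space theta) (fun t => g t * f t).

Definition ker_toeplitz (theta g : circle_fun) : set circle_fun :=
  [set f | model_space theta f /\
           {ae m, forall t, truncated_toeplitz theta g f t = 0}].

(* Closedness, applied to constant sequences, also makes M stable under
   equality almost everywhere in L2. *)
Definition closed_subspace (M : set circle_fun) : Prop :=
  [/\ M `<=` L2,
      M (fun=> 0),
      (forall f g, M f -> M g -> M (fun t => f t + g t)),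
      (forall (c : C) f, M f -> M (fun t => c * f t)) &
      (forall (u : nat -> circle_fun) f, (forall k, M (u k)) -> L2 f ->
         norm_Lp 2%:E (fun t => u k t - f t) @[k --> \oo] --> 0%E -> M f)].

(* (f(z) - f(0)) / z, on boundary functions. *)
Definition backward_shift (f : circle_fun) : circle_fun :=
  fun t => (f t - disc_ext f 0) / eit t.

Definition nearly_Sstar_invariant (M : set circle_fun) : Prop :=
  [/\ closed_subspace M, M `<=` H2 &
      forall f, M f -> disc_ext f 0 = 0 -> M (backward_shift f)].

Definition zpow_H2 (n : nat) : set circle_fun :=
  mul_set (fun t => eit t ^+ n) H2.

Definition div_zpow (M : set circle_fun) (n : nat) : set circle_fun :=
  mul_set (fun t => eit t ^- n) M.

End HardySpace.

(* Main.v *)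
Require Import Defs.
From mathcomp Require Import all_boot all_order all_algebra.
From mathcomp Require Import complex.
From mathcomp Require Import all_classical all_reals all_analysis.
From mathcomp Require Import measurable_realfun ess_sup_inf.
From mathcomp Require Import ring lra.

(** Write K for the model space of theta, z for the coordinate [eit], and
    f(0) for the mean of f in H2, which is also the value at 0 of its extension
    to the disc.

    The kernel of the truncated Toeplitz operator consists of the f in K with
    g f orthogonal to K ([ker_toeplitzP]); this uses that the orthogonal
    projection onto K exists, hence the completeness of L2
    ([projection_exists]). It follows that the kernel, and its quotient by z^n,
    are closed. What remains is the shift: if z^n f lies in the kernel and
    f(0) = 0, then z^n f / z must lie in the kernel.

    The function z^n f / z is again in K, and for k in K the inner product of
    g z^n f / z with k is that of g z^n f with z k. Now z k need not be in K,
    but it is so up to a multiple of theta ([model_space_eit_mul]). Hence the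
    only obstruction is the number <g z^n f, theta>.

    This obstruction vanishes as soon as the kernel contains some z^n f0 with
    f0(0) <> 0, and the maximality of n provides such an f0. Indeed
    theta conj(f0 - f0(0)) lies in K ([model_space_unshift]), so that
    f0(0) <g z^n f, theta> = <g z^n f, theta conj(f0)>, and the right-hand side
    is the integral of g z^n f f0 conj(theta), which is symmetric in f and f0.
    Therefore f0(0) <g z^n f, theta> = f(0) <g z^n f0, theta> = 0
    ([ker_pairing_symmetry]).

    All facts about H2 are derived from one description: H2 is the L2-closure of
    the polynomials in z ([H2P]). Boundary functions are limits of dilates of a
    power series, and dilates are limits of polynomials. Conversely the Fourier
    coefficients of a limit of polynomials are square summable by Bessel's
    inequality, and the dilates of the resulting power series converge to the
    given function because they depend on it contractively. *)

Set Implicit Arguments.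
Unset Strict Implicit.
Unset Printing Implicit Defensive.

Import Order.TTheory GRing.Theory Num.Theory.
Import numFieldNormedType.Exports.

Local Open Scope classical_set_scope.
Local Open Scope ring_scope.
Local Open Scope complex_scope.

Section Circle.
Context (R : realType).

Local Notation m := (circle_measure R).
Local Notation C := R[i].
Local Notation circle_fun := (R -> C).
Local Notation normc := Normc.normc.
Local Notation Re := (@complex.Re R).
Local Notation Im := (@complex.Im R).
Implicit Types (f g h u v k x y : circle_fun) (c z w : C) (t : R).

(** * Square-integrable functions on the circle *)

(** The measure lives on [measurableTypeR R], whose carrier is [R] only up to
    conversion; these wrappers select the filter instance for it once. *)
Lemma ae_all (P : R -> Prop) : (forall t, P t) -> {ae m, forall t, P t}.
Proof. by move=> h; apply: (@filterE _ _ (ae_filter_ringOfSetsType m)). Qed.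

Lemma ae_imply (P Q : R -> Prop) : (forall t, P t -> Q t) ->
  {ae m, forall t, P t} -> {ae m, forall t, Q t}.
Proof. by move=> h; apply: (@filterS _ _ (ae_filter_ringOfSetsType m)). Qed.

Lemma ae_imply2 (P Q S : R -> Prop) : (forall t, P t -> Q t -> S t) ->
  {ae m, forall t, P t} -> {ae m, forall t, Q t} -> {ae m, forall t, S t}.
Proof. by move=> h; apply: (@filterS2 _ _ (ae_filter_ringOfSetsType m)). Qed.

Lemma circle_measureT : m [set: measurableTypeR R] = 1%E.
Proof. exact: probability_setT. Qed.

Lemma circle_measure_lty : (m [set: measurableTypeR R] < +oo)%E.
Proof. by rewrite circle_measureT ltry. Qed.

Definition sqnorm z : R := Re z ^+ 2 + Im z ^+ 2.

Lemma ReB z w : Re (z - w) = Re z - Re w.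
Proof. by case: z w => ? ? []. Qed.

Lemma ImB z w : Im (z - w) = Im z - Im w.
Proof. by case: z w => ? ? []. Qed.

Lemma sqnorm_ge0 z : 0 <= sqnorm z.
Proof. by rewrite addr_ge0 // sqr_ge0. Qed.

Lemma normc_sqr z : normc z ^+ 2 = sqnorm z.
Proof. by case: z => a b; rewrite /= sqr_sqrtr // addr_ge0 // sqr_ge0. Qed.

Lemma normc_ge0 z : 0 <= normc z.
Proof. by case: z => a b; exact: sqrtr_ge0. Qed.

Lemma sqnormM z w : sqnorm (z * w) = sqnorm z * sqnorm w.
Proof. by rewrite -!normc_sqr Normc.normcM exprMn. Qed.

Lemma sqnorm_conj z : sqnorm z^*%C = sqnorm z.
Proof. by case: z => a b; rewrite /sqnorm /= sqrrN. Qed.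

Lemma sqnorm_eq0 z : sqnorm z = 0 -> z = 0.
Proof.
by rewrite -normc_sqr => /eqP; rewrite sqrf_eq0 => /eqP /Normc.eq0_normc.
Qed.

Lemma mul_conj z : z * z^*%C = (sqnorm z)%:C.
Proof. by case: z => a b; rewrite /sqnorm /=; simpc; congr (_ +i* _); ring. Qed.

Lemma sqnormD_le z w : sqnorm (z + w) <= 2 * sqnorm z + 2 * sqnorm w.
Proof.
case: z w => a b [c d]; rewrite /sqnorm /=.
by have := sqr_ge0 (a - c); have := sqr_ge0 (b - d); nra.
Qed.

Lemma conjM z w : (z * w)^*%C = z^*%C * w^*%C.
Proof. exact: (rmorphM conjc). Qed.

Lemma conjD z w : (z + w)^*%C = z^*%C + w^*%C.
Proof. exact: (rmorphD conjc). Qed.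

Lemma conjB z w : (z - w)^*%C = z^*%C - w^*%C.
Proof. exact: (rmorphB conjc). Qed.

Definition cmeasurable f :=
  measurable_fun [set: measurableTypeR R] (Re \o f) /\
  measurable_fun [set: measurableTypeR R] (Im \o f).

Lemma cmeasurable_cst c : cmeasurable (fun=> c).
Proof. by split; exact: measurable_cst. Qed.

Lemma cmeasurableD f g : cmeasurable f -> cmeasurable g ->
  cmeasurable (fun t => f t + g t).
Proof.
move=> [f1 f2] [g1 g2]; split.
  apply: (eq_measurable_fun (fun t => Re (f t) + Re (g t))).
    by move=> t _ /=; case: (f t) (g t) => ? ? [].
  exact: measurable_funD.
apply: (eq_measurable_fun (fun t => Im (f t) + Im (g t))).
  by move=> t _ /=; case: (f t) (g t) => ? ? [].
exact: measurable_funD.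
Qed.

Lemma cmeasurableM f g : cmeasurable f -> cmeasurable g ->
  cmeasurable (fun t => f t * g t).
Proof.
move=> [f1 f2] [g1 g2]; split.
  apply: (eq_measurable_fun
    (fun t => Re (f t) * Re (g t) - Im (f t) * Im (g t))).
    by move=> t _ /=; case: (f t) (g t) => ? ? [].
  by apply: measurable_funB; exact: measurable_funM.
apply: (eq_measurable_fun
  (fun t => Re (f t) * Im (g t) + Im (f t) * Re (g t))).
  by move=> t _ /=; case: (f t) (g t) => ? ? [].
by apply: measurable_funD; exact: measurable_funM.
Qed.

Lemma cmeasurable_conj f : cmeasurable f -> cmeasurable (fun t => (f t)^*%C).
Proof.
move=> [f1 f2]; split.
  by apply: (eq_measurable_fun (Re \o f)) => // t _ /=; case: (f t).
apply: (eq_measurable_fun (fun t => - Im (f t))).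
  by move=> t _ /=; case: (f t).
exact: measurableT_comp.
Qed.

Lemma cmeasurableN f : cmeasurable f -> cmeasurable (fun t => - f t).
Proof.
move=> /(cmeasurableM (cmeasurable_cst (-1))); congr (cmeasurable _).
by apply/funext => t; rewrite mulN1r.
Qed.

Lemma measurable_sqnorm f : cmeasurable f ->
  measurable_fun [set: measurableTypeR R] (fun t => sqnorm (f t)).
Proof.
by move=> [f1 f2]; apply: measurable_funD; exact: measurable_funX.
Qed.

(** Kept in [\bar R] so that Fatou's lemma applies to functions that are not yet
    known to be square integrable. *)
Definition energy f : \bar R := (\int[m]_t (sqnorm (f t))%:E)%E.

Lemma energy_ge0 f : (0 <= energy f)%E.
Proof. by apply: integral_ge0 => t _; rewrite lee_fin sqnorm_ge0. Qed.

Lemma norm_L2E f : norm_Lp 2%:E f = (energy f `^ 2^-1)%E.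
Proof.
rewrite /norm_Lp unlock /energy; congr (_ `^ _)%E.
apply: eq_integral => t _.
rewrite gee0_abs ?lee_fin ?normc_ge0 // poweR_EFin powR_mulrn ?normc_ge0 //.
by rewrite normc_sqr.
Qed.

Lemma L2P f : L2 f <-> cmeasurable f /\ (energy f < +oo)%E.
Proof.
rewrite /L2 /Lp /= norm_L2E; split.
  move=> [f1 f2 Nf]; split; first by split.
  by apply: lty_poweRy Nf; rewrite invr_neq0 // pnatr_eq0.
move=> [[f1 f2] fy]; split=> //.
by rewrite poweR_lty.
Qed.

Lemma L2_cmeasurable f : L2 f -> cmeasurable f.
Proof. by move=> /L2P[]. Qed.

Lemma L2_energy f : L2 f -> (energy f < +oo)%E.
Proof. by move=> /L2P[]. Qed.

Lemma L2_sqnorm_integrable f : L2 f ->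
  m.-integrable [set: measurableTypeR R] (fun t => (sqnorm (f t))%:E).
Proof.
move=> /L2P[mf fy]; apply/integrableP; split.
  by apply/measurable_EFinP; exact: measurable_sqnorm.
by under eq_integral => t _ do rewrite gee0_abs ?lee_fin ?sqnorm_ge0 //.
Qed.

Lemma L2_dominated f g (B : R) : cmeasurable f -> L2 g ->
  {ae m, forall t, sqnorm (f t) <= B * sqnorm (g t)} -> L2 f.
Proof.
move=> mf Lg fg; apply/L2P; split=> //.
have Bg := integrableZl measurableT B (L2_sqnorm_integrable Lg).
have : (energy f <= \int[m]_t `|B%:E * (sqnorm (g t))%:E|)%E.
  apply: ae_ge0_le_integral => //.
  - by move=> t _; rewrite lee_fin sqnorm_ge0.
  - by apply/measurable_EFinP; exact: measurable_sqnorm.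
  - apply: measurableT_comp => //; exact: measurable_int Bg.
  - apply: ae_imply fg => t fg _; rewrite -EFinM abse_EFin lee_fin.
    exact: le_trans fg (ler_norm _).
by move=> /le_lt_trans; apply; case/integrableP: Bg.
Qed.

(** * The inner product *)

Lemma L2D f g : L2 f -> L2 g -> L2 (fun t => f t + g t).
Proof.
move=> Lf Lg; apply/L2P; split.
  by apply: cmeasurableD; exact: L2_cmeasurable.
have If := integrableZl measurableT 2 (L2_sqnorm_integrable Lf).
have Ig := integrableZl measurableT 2 (L2_sqnorm_integrable Lg).
have Ifg := integrableD measurableT If Ig.
apply: le_lt_trans (proj2 (integrableP _ _ _ Ifg)).
apply: ge0_le_integral => //.
- by move=> t _; rewrite lee_fin sqnorm_ge0.
- apply/measurable_EFinP; apply: measurable_sqnorm.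
  by apply: cmeasurableD; exact: L2_cmeasurable.
- by apply: measurableT_comp => //; exact: measurable_int Ifg.
- move=> t _ /=; rewrite lee_fin.
  exact: le_trans (sqnormD_le _ _) (ler_norm _).
Qed.

Lemma L2_mul_bounded phi (B : R) f : cmeasurable phi ->
  {ae m, forall t, sqnorm (phi t) <= B} -> L2 f -> L2 (fun t => phi t * f t).
Proof.
move=> mphi phiB Lf; apply: (L2_dominated (g := f) (B := B)) => //.
  by apply: cmeasurableM => //; exact: L2_cmeasurable.
apply: ae_imply phiB => t phiB.
by rewrite sqnormM ler_wpM2r // sqnorm_ge0.
Qed.

Lemma L2Z c f : L2 f -> L2 (fun t => c * f t).
Proof.
apply: (L2_mul_bounded (B := sqnorm c) (cmeasurable_cst c)).
exact: ae_all.
Qed.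

Lemma L2N f : L2 f -> L2 (fun t => - f t).
Proof.
move=> /(L2Z (-1)); congr (L2 _).
by apply/funext => t; rewrite mulN1r.
Qed.

Lemma L2B f g : L2 f -> L2 g -> L2 (fun t => f t - g t).
Proof. by move=> Lf Lg; apply: L2D => //; exact: L2N. Qed.

Lemma L2_conj f : L2 f -> L2 (fun t => (f t)^*%C).
Proof.
move=> Lf; apply: (L2_dominated (g := f) (B := 1)) => //.
  by apply: cmeasurable_conj; exact: L2_cmeasurable.
by apply: ae_all => t; rewrite sqnorm_conj mul1r.
Qed.

Lemma L2_cst c : L2 (fun=> c).
Proof.
apply/L2P; split; first exact: cmeasurable_cst.
rewrite /energy integral_cst // [X in (_ * X)%E](_ : _ = 1%E) ?mule1 ?ltry //.
exact: circle_measureT.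
Qed.

Lemma L2_Linfty_mul f g : Linfty g -> L2 f -> L2 (fun t => g t * f t).
Proof.
move=> [g1 g2]; rewrite /norm_Lp unlock.
rewrite [X in (0 < X)%E](_ : _ = 1%E) ?lte01; last exact: circle_measureT.
move=> ginf Lf.
set N := ess_sup _ _ in ginf.
have : (N <= (fine (maxe N 0))%:E)%E.
  rewrite fineK; first by rewrite le_max lexx.
  rewrite ge0_fin_numE ?le_max ?lexx ?orbT //.
  by rewrite gt_max ginf ltry.
move=> /ess_supP gB.
have mg : cmeasurable g by split.
apply: (L2_mul_bounded (B := fine (maxe N 0%E) ^+ 2)) mg _ Lf.
apply: ae_imply gB => t /=.
rewrite lee_fin ger0_norm ?normc_ge0 // -normc_sqr.
by rewrite -ler_sqr ?nnegrE ?normc_ge0 // fine_ge0 // le_max lexx orbT.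
Qed.

Definition cintegrable f :=
  m.-integrable [set: measurableTypeR R] (EFin \o (Re \o f)) /\
  m.-integrable [set: measurableTypeR R] (EFin \o (Im \o f)).

Lemma L2_mul_conj_integrable f g : L2 f -> L2 g ->
  cintegrable (fun t => f t * (g t)^*%C).
Proof.
move=> Lf Lg.
have Ifg := integrableD measurableT (L2_sqnorm_integrable Lf)
  (L2_sqnorm_integrable Lg).
have [m1 m2] : cmeasurable (fun t => f t * (g t)^*%C).
  apply: cmeasurableM; first exact: L2_cmeasurable.
  by apply: cmeasurable_conj; exact: L2_cmeasurable.
have bnd (x y : C) :
    `|Re (x * y^*%C)| <= sqnorm x + sqnorm y /\
    `|Im (x * y^*%C)| <= sqnorm x + sqnorm y.
  case: x y => a b [c d]; rewrite /sqnorm /= !ler_norml.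
  have := (sqr_ge0 (a - c), sqr_ge0 (b - d), sqr_ge0 (a + c), sqr_ge0 (b + d)).
  have := (sqr_ge0 (a - d), sqr_ge0 (b - c), sqr_ge0 (a + d), sqr_ge0 (b + c)).
  move=> [[[h1 h2] h3] h4] [[[h5 h6] h7] h8].
  by split; apply/andP; split; nra.
have pos (x y : C) : 0 <= sqnorm x + sqnorm y by rewrite addr_ge0 ?sqnorm_ge0.
by split; apply: le_integrable Ifg => //; try exact/measurable_EFinP;
  move=> t _ /=; rewrite lee_fin;
  rewrite [X in (_ <= X)%R]ger0_norm ?pos //; apply bnd.
Qed.

Lemma circle_intD f g : cintegrable f -> cintegrable g ->
  circle_int (fun t => f t + g t) = circle_int f + circle_int g.
Proof.
move=> [f1 f2] [g1 g2]; rewrite /circle_int; simpc; congr (_ +i* _).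
  by rewrite -RintegralD //; apply: eq_Rintegral => t _; case: (f t) (g t) => ? ? [].
by rewrite -RintegralD //; apply: eq_Rintegral => t _; case: (f t) (g t) => ? ? [].
Qed.

Lemma circle_intZ c f : cintegrable f ->
  circle_int (fun t => c * f t) = c * circle_int f.
Proof.
case: c => a b [f1 f2]; rewrite /circle_int; simpc.
have Z (r : R) (p : R -> R) :
    m.-integrable [set: measurableTypeR R] (EFin \o p) ->
    m.-integrable [set: measurableTypeR R] (EFin \o (fun t => r * p t)).
  exact: integrableZl.
congr (_ +i* _).
  rewrite -!RintegralZl // -RintegralB //; [|exact: Z..].
  by apply: eq_Rintegral => t _; case: (f t).
rewrite -!RintegralZl // -RintegralD //; [|exact: Z..].
by apply: eq_Rintegral => t _; case: (f t).
Qed.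

Lemma circle_int_conj f : cintegrable f ->
  circle_int (fun t => (f t)^*%C) = (circle_int f)^*%C.
Proof.
move=> [_ f2]; rewrite /circle_int /=; congr (_ +i* _).
  by apply: eq_Rintegral => t _; case: (f t).
rewrite -mulN1r -RintegralZl //.
by apply: eq_Rintegral => t _; rewrite mulN1r; case: (f t).
Qed.

Lemma circle_int_ae f g : cmeasurable f -> cmeasurable g ->
  {ae m, forall t, f t = g t} -> circle_int f = circle_int g.
Proof.
move=> [f1 f2] [g1 g2] fg; rewrite /circle_int /Rintegral; congr (_ +i* _).
  congr fine; apply: ae_eq_integral => //; [exact/measurable_EFinP..|].
  by apply: ae_imply fg => t ->.
congr fine; apply: ae_eq_integral => //; [exact/measurable_EFinP..|].
by apply: ae_imply fg => t ->.
Qed.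

Lemma inner_prodDl f g h : L2 f -> L2 g -> L2 h ->
  inner_prod (fun t => f t + g t) h = inner_prod f h + inner_prod g h.
Proof.
move=> Lf Lg Lh; rewrite /inner_prod -circle_intD;
  [|exact: L2_mul_conj_integrable..].
by congr circle_int; apply/funext => t; rewrite mulrDl.
Qed.

Lemma inner_prodZl c f h : L2 f -> L2 h ->
  inner_prod (fun t => c * f t) h = c * inner_prod f h.
Proof.
move=> Lf Lh; rewrite /inner_prod -circle_intZ;
  last exact: L2_mul_conj_integrable.
by congr circle_int; apply/funext => t; rewrite mulrA.
Qed.

Lemma inner_prod_conj f g : L2 f -> L2 g ->
  inner_prod g f = (inner_prod f g)^*%C.
Proof.
move=> Lf Lg; rewrite /inner_prod -circle_int_conj;
  last exact: L2_mul_conj_integrable.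
by congr circle_int; apply/funext => t; rewrite conjM conjcK mulrC.
Qed.

Lemma inner_prodDr f g h : L2 f -> L2 g -> L2 h ->
  inner_prod h (fun t => f t + g t) = inner_prod h f + inner_prod h g.
Proof.
move=> Lf Lg Lh; rewrite inner_prod_conj ?inner_prodDl ?conjD //; last exact: L2D.
by rewrite -!inner_prod_conj.
Qed.

Lemma inner_prodZr c f h : L2 f -> L2 h ->
  inner_prod h (fun t => c * f t) = c^*%C * inner_prod h f.
Proof.
move=> Lf Lh; rewrite inner_prod_conj ?inner_prodZl ?conjM //; last exact: L2Z.
by rewrite -inner_prod_conj.
Qed.

Lemma inner_prodBl f g h : L2 f -> L2 g -> L2 h ->
  inner_prod (fun t => f t - g t) h = inner_prod f h - inner_prod g h.
Proof.
move=> Lf Lg Lh; rewrite -mulN1r -inner_prodZl // -inner_prodDl //; last exact: L2Z.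
by congr inner_prod; apply/funext => t; rewrite mulN1r.
Qed.

Lemma inner_prodBr f g h : L2 f -> L2 g -> L2 h ->
  inner_prod h (fun t => f t - g t) = inner_prod h f - inner_prod h g.
Proof.
move=> Lf Lg Lh; rewrite inner_prod_conj ?inner_prodBl ?conjB //; last exact: L2B.
by rewrite -!inner_prod_conj.
Qed.

Lemma inner_prod_ae f f' g g' : L2 f -> L2 f' -> L2 g -> L2 g' ->
  {ae m, forall t, f t = f' t} -> {ae m, forall t, g t = g' t} ->
  inner_prod f g = inner_prod f' g'.
Proof.
move=> /L2_cmeasurable mf /L2_cmeasurable mf' /L2_cmeasurable mg.
move=> /L2_cmeasurable mg' ff' gg'; apply: circle_int_ae.
- by apply: cmeasurableM => //; exact: cmeasurable_conj.
- by apply: cmeasurableM => //; exact: cmeasurable_conj.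
- by apply: ae_imply2 ff' gg' => t -> ->.
Qed.

Lemma circle_int_cst c : circle_int (fun=> c) = c.
Proof.
rewrite /circle_int /= !Rintegral_cst //.
rewrite [X in fine X](_ : _ = 1%E); last exact: circle_measureT.
by rewrite !mulr1; case: c.
Qed.

Definition nrm2 f : R := Re (inner_prod f f).

Lemma inner_prod_self f : inner_prod f f = (nrm2 f)%:C.
Proof.
rewrite /nrm2 /inner_prod /circle_int; congr (_ +i* _).
under eq_Rintegral => t _ do rewrite mul_conj /=.
by rewrite Rintegral_cst // mul0r.
Qed.

Lemma nrm2_cst c : nrm2 (fun=> c) = sqnorm c.
Proof. by rewrite /nrm2 /inner_prod circle_int_cst mul_conj. Qed.

Lemma nrm2_0 : nrm2 (fun=> 0) = 0.
Proof. by rewrite nrm2_cst /sqnorm /= expr0n addr0. Qed.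

Lemma nrm2E f : nrm2 f = fine (energy f).
Proof.
rewrite /nrm2 /inner_prod /circle_int /=; congr fine.
by apply: eq_integral => t _; rewrite mul_conj.
Qed.

Lemma energyE f : L2 f -> energy f = (nrm2 f)%:E.
Proof.
by move=> /L2_energy fy; rewrite nrm2E fineK // ge0_fin_numE // energy_ge0.
Qed.

Lemma nrm2_ge0 f : 0 <= nrm2 f.
Proof. by rewrite nrm2E fine_ge0 // energy_ge0. Qed.

Lemma nrm2_eq0 f : L2 f -> nrm2 f = 0 -> {ae m, forall t, f t = 0}.
Proof.
move=> Lf f0.
have : (\int[m]_t `|(sqnorm (f t))%:E|)%E = 0%E.
  transitivity (energy f); last by rewrite energyE // f0.
  by apply: eq_integral => t _; rewrite gee0_abs // lee_fin sqnorm_ge0.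
have mf : measurable_fun [set: measurableTypeR R] (fun t => (sqnorm (f t))%:E).
  by apply/measurable_EFinP; apply: measurable_sqnorm; exact: L2_cmeasurable.
move=> /(ae_eq_integral_abs m measurableT mf).
by apply: ae_imply => t /(_ I) [] /sqnorm_eq0.
Qed.

(** * Squared norms and the Cauchy-Schwarz inequality *)

Lemma nrm2_inner_prodB x k : L2 x -> L2 k ->
  nrm2 (fun t => x t - k t) = nrm2 x + nrm2 k - Re (inner_prod x k) *+ 2.
Proof.
move=> Lx Lk; rewrite /nrm2 inner_prodBl ?inner_prodBr //; last exact: L2B.
rewrite (inner_prod_conj Lx Lk).
case: (inner_prod x x) (inner_prod x k) (inner_prod k k) => a b [c d] [e f] /=.
by ring.
Qed.

Lemma nrm2D x k : L2 x -> L2 k ->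
  nrm2 (fun t => x t + k t) = nrm2 x + nrm2 k + Re (inner_prod x k) *+ 2.
Proof.
move=> Lx Lk; rewrite /nrm2 inner_prodDl ?inner_prodDr //; last exact: L2D.
rewrite (inner_prod_conj Lx Lk).
case: (inner_prod x x) (inner_prod x k) (inner_prod k k) => a b [c d] [e f] /=.
by ring.
Qed.

Lemma nrm2Z c x : L2 x -> nrm2 (fun t => c * x t) = sqnorm c * nrm2 x.
Proof.
move=> Lx; rewrite /nrm2 inner_prodZl ?inner_prodZr //; last exact: L2Z.
rewrite mulrA mul_conj; rewrite inner_prod_self.
by rewrite /= mul0r subr0.
Qed.

Lemma nrm2N x : L2 x -> nrm2 (fun t => - x t) = nrm2 x.
Proof.
move=> Lx; rewrite -[RHS]mul1r -[1](_ : sqnorm (-1 : C) = 1); last first.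
  by rewrite /sqnorm /=; ring.
by rewrite -nrm2Z //; congr nrm2; apply/funext => t; rewrite mulN1r.
Qed.

Lemma nrm2_distC f g : L2 f -> L2 g ->
  nrm2 (fun t => f t - g t) = nrm2 (fun t => g t - f t).
Proof.
move=> Lf Lg; rewrite -[RHS]nrm2N; last exact: L2B.
by congr nrm2; apply/funext => t; rewrite opprB.
Qed.

Lemma nrm2_parallelogram x k : L2 x -> L2 k ->
  nrm2 (fun t => x t + k t) + nrm2 (fun t => x t - k t) =
  2 * nrm2 x + 2 * nrm2 k.
Proof. by move=> Lx Lk; rewrite nrm2D // nrm2_inner_prodB //; ring. Qed.

Lemma nrm2D_le x k : L2 x -> L2 k ->
  nrm2 (fun t => x t + k t) <= 2 * nrm2 x + 2 * nrm2 k.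
Proof.
by move=> Lx Lk; rewrite -nrm2_parallelogram // lerDl nrm2_ge0.
Qed.

Lemma nrm2B_le x k : L2 x -> L2 k ->
  nrm2 (fun t => x t - k t) <= 2 * nrm2 x + 2 * nrm2 k.
Proof.
by move=> Lx Lk; rewrite -nrm2_parallelogram // lerDr nrm2_ge0.
Qed.

(** If subtracting multiples of [k] lowers the squared norm of [x] by at most
    [d], then the correlation of [x] with [k] is small: test the multiple
    [tau * <x, k>] with the best real [tau]. For [d = nrm2 x] this is the
    Cauchy-Schwarz inequality; for a minimising sequence it yields the
    orthogonality relations of the projection theorem. *)
Lemma almost_orthogonal x k (d : R) : L2 x -> L2 k -> 0 <= d ->
  (forall c, nrm2 x - d <= nrm2 (fun t => x t - c * k t)) ->
  sqnorm (inner_prod x k) <= d * nrm2 k.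
Proof.
move=> Lx Lk d0 H; set s := sqnorm _.
have s0 : 0 <= s by exact: sqnorm_ge0.
have test (tau : R) : 2 * tau * s - tau ^+ 2 * s * nrm2 k <= d.
  have := H (tau%:C * inner_prod x k).
  rewrite nrm2_inner_prodB // ?nrm2Z ?inner_prodZr //; last exact: L2Z.
  rewrite sqnormM -/s conjM -(mulrA _ _ (inner_prod x k)).
  rewrite [_ * inner_prod x k]mulrC mul_conj -/s.
  by rewrite /sqnorm /= => h; nra.
have := nrm2_ge0 k; rewrite le_eqVlt => /orP[/eqP K0|K0].
  rewrite -K0 mulr0 leNgt; apply/negP => sp.
  have := test ((d + 1) / (2 * s)).
  rewrite -K0 mulr0 subr0.
  have -> : 2 * ((d + 1) / (2 * s)) * s = d + 1 by field; rewrite gt_eqF.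
  by rewrite leNgt ltrDl ltr01.
have := test (nrm2 k)^-1.
have -> : 2 * (nrm2 k)^-1 * s - (nrm2 k)^-1 ^+ 2 * s * nrm2 k = s / nrm2 k.
  by field; rewrite gt_eqF.
by rewrite ler_pdivrMr.
Qed.

Lemma cauchy_schwarz f g : L2 f -> L2 g ->
  sqnorm (inner_prod f g) <= nrm2 f * nrm2 g.
Proof.
move=> Lf Lg; apply: almost_orthogonal => //; first exact: nrm2_ge0.
by move=> c; rewrite subrr nrm2_ge0.
Qed.

Lemma nrm2_ae f g : L2 f -> L2 g -> {ae m, forall t, f t = g t} ->
  nrm2 f = nrm2 g.
Proof. by move=> Lf Lg fg; rewrite /nrm2 (@inner_prod_ae _ g _ g). Qed.

(** Squared distances keep square roots out of the L2 estimates. The filter is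
    arbitrary, so as to cover both sequences and radial limits. *)
Lemma norm_L2_cvg0P (T : Type) (F : set_system T) (u : T -> circle_fun) :
  Filter F -> (\forall i \near F, L2 (u i)) ->
  (norm_Lp 2%:E (u i) @[i --> F] --> 0%E) <->
  (forall e : R, 0 < e -> \forall i \near F, nrm2 (u i) < e).
Proof.
move=> FF Lu.
have NE i : L2 (u i) -> norm_Lp 2%:E (u i) = (Num.sqrt (nrm2 (u i)))%:E.
  move=> L; rewrite norm_L2E energyE // poweR_EFin powR12_sqrt ?nrm2_ge0 //.
split.
  move=> /fine_cvgP[_ /cvgrPdist_lt h] e e0.
  have := h (Num.sqrt e); rewrite sqrtr_gt0 => /(_ e0).
  apply: filterS2 Lu => i Lx.
  rewrite /= NE //= sub0r normrN ger0_norm ?sqrtr_ge0 //.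
  by rewrite ltr_sqrt.
move=> h; apply/fine_cvgP; split.
  by apply: filterS Lu => i Lx; rewrite NE.
apply/cvgrPdist_lt => e e0.
have := h (e ^+ 2); rewrite exprn_gt0 // => /(_ isT).
apply: filterS2 Lu => i Lx he.
rewrite /= NE //= sub0r normrN ger0_norm ?sqrtr_ge0 //.
by rewrite -[ltRHS](@ger0_norm _ e) ?ltW // -sqrtr_sqr ltr_sqrt // exprn_gt0.
Qed.

(** * Completeness of L2 *)

(** Convergence of real and imaginary parts, the form in which measurability and
    Fatou's lemma are available. *)
Definition ccvg (a : nat -> C) z :=
  (Re (a n) @[n --> \oo] --> Re z) /\ (Im (a n) @[n --> \oo] --> Im z).

Lemma ccvg_sqnorm (a : nat -> C) z : ccvg a z ->
  sqnorm (a n) @[n --> \oo] --> sqnorm z.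
Proof.
move=> [h1 h2]; rewrite /sqnorm; under eq_fun do rewrite !expr2.
by rewrite !expr2; apply: cvgD; apply: cvgM.
Qed.

Lemma ccvg_shift p (a : nat -> C) z : ccvg a z -> ccvg (fun n => a (p + n)%N) z.
Proof.
move=> [h1 h2]; split.
  by under eq_fun do rewrite addnC; move: h1; rewrite -(cvg_shiftn p).
by under eq_fun do rewrite addnC; move: h2; rewrite -(cvg_shiftn p).
Qed.

Lemma ccvgBl w (a : nat -> C) z : ccvg a z -> ccvg (fun n => w - a n) (w - z).
Proof.
move=> [h1 h2]; split; [under eq_fun do rewrite ReB|under eq_fun do rewrite ImB].
  by rewrite ReB; apply: cvgB => //; exact: cvg_cst.
by rewrite ImB; apply: cvgB => //; exact: cvg_cst.
Qed.

Lemma ccvgBr w (a : nat -> C) z : ccvg a z -> ccvg (fun n => a n - w) (z - w).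
Proof.
move=> [h1 h2]; split; [under eq_fun do rewrite ReB|under eq_fun do rewrite ImB].
  by rewrite ReB; apply: cvgB => //; exact: cvg_cst.
by rewrite ImB; apply: cvgB => //; exact: cvg_cst.
Qed.

Lemma energy_fatou (F : nat -> circle_fun) f (B : \bar R) :
  (forall n, cmeasurable (F n)) -> cmeasurable f ->
  {ae m, forall t, ccvg (F ^~ t) (f t)} ->
  (forall n, (energy (F n) <= B)%E) -> (energy f <= B)%E.
Proof.
move=> mF mf Ff FB.
pose s n t := (sqnorm (F n t))%:E.
have ms n : measurable_fun [set: measurableTypeR R] (s n).
  by apply/measurable_EFinP; exact: measurable_sqnorm.
have s0 n t : (0 <= s n t)%E by rewrite lee_fin sqnorm_ge0.
have -> : energy f = (\int[m]_t limn_einf (s ^~ t))%E.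
  apply: ae_eq_integral => //.
  - by apply/measurable_EFinP; exact: measurable_sqnorm.
  - under eq_fun do rewrite /limn_einf.
    apply: measurableT_comp => //; apply: measurable_fun_limn_esup => n.
    exact: measurableT_comp.
  - apply: ae_imply Ff => t /ccvg_sqnorm Ft _.
    have sf : s ^~ t @ \oo --> (sqnorm (f t))%:E.
      by apply/fine_cvgP; split => //; exact: nearW.
    by have [-> _] := cvg_limn_einf_sup sf.
apply: le_trans (@fatou _ _ _ m _ measurableT s ms (fun n t _ => s0 n t)) _.
rewrite limn_einf_lim; apply: lime_le; first exact: is_cvg_einfs.
apply: nearW => n; apply: le_trans (FB n).
by apply: ereal_inf_lbound; exists n => /=.
Qed.

Lemma fast_cauchy_cvgn (a : nat -> R) (s : R) : 0 <= s ->
  (forall n, `|a n.+1 - a n| <= s * 2^-1 ^+ n) -> cvgn a.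
Proof.
move=> s0 h.
have -> : a = (fun n => a 0%N + series (telescope a) n).
  by apply/funext => n; exact: eq_sum_telescope.
apply: is_cvgD; first exact: is_cvg_cst.
apply: normed_cvg; apply: (@series_le_cvg _ _ (geometric s 2^-1)) => //=.
- by move=> n; rewrite mulr_ge0 // exprn_ge0 // invr_ge0.
- apply: is_cvg_geometric_series.
  by rewrite ger0_norm ?invr_ge0 // invf_lt1 // ltr1n.
Qed.

(** Weighting the squared increments by [4 ^+ n] keeps the sum of their
    integrals finite, because the ratio [4 / 16] is less than 1; at almost every
    point the increments are therefore bounded by a multiple of [2^-1 ^+ n]. *)
Lemma fast_cauchy_ae_cvg (F : nat -> circle_fun) (K : R) :
  (forall n, L2 (F n)) ->
  (forall n, nrm2 (fun t => F n.+1 t - F n t) <= K / 16 ^+ n) ->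
  {ae m, forall t, exists z, ccvg (F ^~ t) z}.
Proof.
move=> LF FK.
have LD n : L2 (fun t => F n.+1 t - F n t) by exact: L2B.
pose s n t := (4 ^+ n * sqnorm (F n.+1 t - F n t))%:E.
have ms n : measurable_fun [set: measurableTypeR R] (s n).
  apply/measurable_EFinP; apply: measurable_funM => //.
  by apply: measurable_sqnorm; exact: L2_cmeasurable.
have s0 n t : (0 <= s n t)%E.
  by rewrite lee_fin mulr_ge0 ?sqnorm_ge0 // exprn_ge0.
have K0 : 0 <= K.
  by have := FK 0%N; rewrite expr0 divr1; apply: le_trans; exact: nrm2_ge0.
have Is n : (\int[m]_t s n t <= (geometric K 4^-1 n)%:E)%E.
  rewrite /s; under eq_integral => t _ do rewrite EFinM.
  rewrite ge0_integralZl_EFin ?exprn_ge0 //; last 2 first.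
  - by move=> t _; rewrite lee_fin sqnorm_ge0.
  - apply/measurable_EFinP; apply: measurable_sqnorm; exact: L2_cmeasurable.
  rewrite -/(energy (fun t => F n.+1 t - F n t)) energyE // -EFinM lee_fin /=.
  apply: le_trans (ler_wpM2l _ (FK n)) _; first by rewrite exprn_ge0.
  rewrite mulrCA ler_wpM2l // -[16](_ : 4 * 4 = 16) ?exprMn; last by ring.
  by rewrite invfM mulrA mulfV ?mul1r ?exprVn // expf_neq0.
have IS : m.-integrable [set: measurableTypeR R]
    (fun t => \sum_(n <oo) s n t)%E.
  apply/integrableP; split; first exact: ge0_emeasurable_sum.
  under eq_integral => t _ do rewrite gee0_abs ?nneseries_ge0 //.
  rewrite integral_nneseries //.
  apply: (@le_lt_trans _ _ (K * (1 - 4^-1)^-1)%:E); last exact: ltry.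
  apply: lime_le.
    by apply: is_cvg_nneseries => n _ _; exact: integral_ge0.
  apply: nearW => n.
  apply: le_trans; first by apply: lee_sum => k _; exact: Is.
  rewrite sumEFin lee_fin; apply: geometric_le_lim => //.
  by rewrite ger0_norm ?invr_ge0 // invf_lt1 // ltr1n.
apply: ae_imply (integrable_ae measurableT IS) => t /(_ I) St.
pose S := fine (\sum_(n <oo) s n t)%E.
have sS n : sqnorm (F n.+1 t - F n t) <= S * (2^-1 ^+ n) ^+ 2.
  have : (s n t <= S%:E)%E.
    rewrite /S fineK //; apply: le_trans (nneseries_lim_ge n.+1 _) => //.
    by rewrite big_nat_recr //= leeDr // sume_ge0.
  rewrite lee_fin -ler_pdivlMl ?exprn_gt0 // mulrC => h; apply: le_trans h _.
  by rewrite -exprVn exprAC expr2 -invfM -natrM.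
have S0 : 0 <= S by rewrite fine_ge0 // nneseries_ge0.
have inc (P : R -> R) (x : nat -> R) : (forall n, (x n.+1 - x n) ^+ 2 <=
    sqnorm (F n.+1 t - F n t)) -> cvgn x.
  move=> h; apply: (@fast_cauchy_cvgn _ (Num.sqrt S)); first exact: sqrtr_ge0.
  move=> n; rewrite -ler_sqr ?nnegrE ?mulr_ge0 ?sqrtr_ge0 ?exprn_ge0 ?invr_ge0 //.
  rewrite real_normK ?num_real // exprMn sqr_sqrtr //.
  exact: le_trans (h n) (sS n).
have c1 : cvgn (fun n => Re (F n t)).
  apply: inc => // n; rewrite /sqnorm.
  by case: (F n.+1 t) (F n t) => a b [c d] /=; rewrite lerDl sqr_ge0.
have c2 : cvgn (fun n => Im (F n t)).
  apply: inc => // n; rewrite /sqnorm.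
  by case: (F n.+1 t) (F n t) => a b [c d] /=; rewrite lerDr sqr_ge0.
by exists (limn (fun n => Re (F n t)) +i* limn (fun n => Im (F n t))); split.
Qed.

(** The pointwise limit exists almost everywhere; an upper limit in [\bar R]
    makes it a measurable function everywhere. Fatou's lemma then passes the
    Cauchy estimates to the limit. *)
Lemma L2_complete (F : nat -> circle_fun) (K : R) :
  (forall n, L2 (F n)) ->
  (forall n p, (n <= p)%N -> nrm2 (fun t => F p t - F n t) <= K / 16 ^+ n) ->
  exists2 f, L2 f & forall n, nrm2 (fun t => F n t - f t) <= K / 16 ^+ n.
Proof.
move=> LF FK.
have aecv := fast_cauchy_ae_cvg LF (fun n => FK n n.+1 (leqnSn n)).
pose lims (P : C -> R) t := fine (limn_esup (fun n => (P (F n t))%:E)).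
pose f : circle_fun := fun t => lims Re t +i* lims Im t.
have mlims P : (forall n, measurable_fun [set: measurableTypeR R] (P \o F n)) ->
    measurable_fun [set: measurableTypeR R] (lims P).
  move=> mP; apply: measurableT_comp => //.
  apply: measurable_fun_limn_esup => n; apply/measurable_EFinP; exact: mP.
have mf : cmeasurable f.
  by split; apply: mlims => n; have [] := L2_cmeasurable (LF n).
have limsE P t (l : R) : P (F n t) @[n --> \oo] --> l -> lims P t = l.
  move=> h.
  have hE : (P (F n t))%:E @[n --> \oo] --> l%:E.
    by apply/fine_cvgP; split => //; exact: nearW.
  by rewrite /lims; have [_ ->] := cvg_limn_einf_sup hE.
have Ff : {ae m, forall t, ccvg (F ^~ t) (f t)}.
  apply: ae_imply aecv => t [z [z1 z2]].
  by rewrite /f (limsE _ _ _ z1) (limsE _ _ _ z2).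
have dist n : (energy (fun t => F n t - f t)%R <= (K / 16 ^+ n)%:E)%E.
  apply: (energy_fatou (F := fun p t => (F n t - F (n + p)%N t)%R)).
  - by move=> p; apply: L2_cmeasurable; exact: L2B.
  - apply: cmeasurableD; first exact: L2_cmeasurable.
    exact: cmeasurableN.
  - apply: ae_imply Ff => t /(ccvg_shift n) Ft; exact: ccvgBl.
  - move=> p; rewrite energyE; last exact: L2B.
    by rewrite lee_fin nrm2_distC //; apply: FK; exact: leq_addr.
have Lf : L2 f.
  have LFf : L2 (fun t => F 0%N t - f t).
    apply/L2P; split; last by apply: le_lt_trans (dist 0%N) _; rewrite ltry.
    apply: cmeasurableD; first exact: L2_cmeasurable.
    exact: cmeasurableN.
  have := L2B (LF 0%N) LFf; congr (L2 _).
  by apply/funext => t; rewrite opprB addrC subrK.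
exists f => // n; rewrite -lee_fin -energyE; last exact: L2B.
exact: dist.
Qed.

(** * Closed subspaces and orthogonal projection *)

Lemma geometric_small (c e : R) : 0 < e -> exists n, c / 16 ^+ n < e.
Proof.
move=> e0.
have z1 : `|16^-1 : R| < 1.
  by rewrite ger0_norm ?invr_ge0 // invf_lt1 // ltr1n.
have /cvgrPdist_lt/(_ e e0)[n _ /(_ n (leqnn n))] /= := cvg_geometric c z1.
rewrite sub0r normrN exprVn => h; exists n.
exact: le_lt_trans (ler_norm _) h.
Qed.

(** Adherence in terms of a single approximant replaces convergent sequences. *)
Definition adherent (M : set circle_fun) f :=
  forall e : R, 0 < e -> exists2 k, M k & nrm2 (fun t => k t - f t) < e.

Lemma closed_subspace_adherent M f : closed_subspace M -> L2 f ->
  adherent M f -> M f.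
Proof.
move=> [ML2 _ _ _ Mcl] Lf Mf.
have /choice[u Mu] : forall n : nat, exists k,
    M k /\ nrm2 (fun t => k t - f t) < n.+1%:R^-1.
  move=> n; have [|k Mk kf] := Mf (n.+1%:R^-1); first by rewrite invr_gt0.
  by exists k.
apply: (Mcl u) => //; first by move=> k; have [] := Mu k.
apply/norm_L2_cvg0P.
  by apply: nearW => n; apply: L2B => //; apply: ML2; have [] := Mu n.
move=> e e0; near=> n.
have [_ /lt_trans] := Mu n; apply.
near: n; exact: near_infty_natSinv_lt (PosNum e0).
Unshelve. all: by end_near. Qed.

Lemma adherent_closed_subspace M : M `<=` @L2 R -> M (fun=> 0) ->
  (forall f g, M f -> M g -> M (fun t => f t + g t)) ->
  (forall c f, M f -> M (fun t => c * f t)) ->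
  (forall f, L2 f -> adherent M f -> M f) -> closed_subspace M.
Proof.
move=> ML2 M0 MD MZ Mcl; split=> // u f Mu Lf uf.
apply: Mcl => // e e0.
have Lu i : L2 (fun t => u i t - f t) by apply: L2B => //; exact: ML2.
have nLu : \forall i \near \oo, L2 (fun t => u i t - f t) by exact: nearW.
have [n _ /(_ n (leqnn n)) hn] := proj1 (norm_L2_cvg0P _ nLu) uf e e0.
by exists (u n).
Qed.

Lemma closed_subspaceB M f g : closed_subspace M -> M f -> M g ->
  M (fun t => f t - g t).
Proof.
move=> [_ _ MD MZ _] Mf Mg.
have := MD _ _ Mf (MZ (-1) _ Mg); congr (M _).
by apply/funext => t; rewrite mulN1r.
Qed.

(** A minimising sequence for the distance is Cauchy by the parallelogram law,
    at the rate chosen for it. Its terms are almost orthogonal to [M], and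
    orthogonality survives in the limit by the Cauchy-Schwarz inequality. *)
Theorem projection_exists M f : closed_subspace M -> L2 f ->
  exists h, M h /\ forall k, M k -> inner_prod (fun t => f t - h t) k = 0.
Proof.
move=> CM Lf; have [ML2 M0 MD MZ _] := CM.
pose S := [set nrm2 (fun t => f t - k t) | k in M].
pose d := inf S.
have S0 : S !=set0 by exists (nrm2 (fun t => f t - 0)), (fun=> 0).
have Slb : has_lbound S by exists 0 => _ [k _ <-]; exact: nrm2_ge0.
have dle k : M k -> d <= nrm2 (fun t => f t - k t).
  by move=> Mk; apply: ge_inf => //; exists k.
have /choice[u Mu] : forall n : nat, exists k,
    M k /\ nrm2 (fun t => f t - k t) < d + 1 / 16 ^+ n.
  move=> n; have e0 : 0 < 1 / 16 ^+ n :> R by rewrite divr_gt0 // exprn_gt0.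
  have [_ [k Mk <-] kd] := inf_adherent e0 (conj S0 Slb).
  by exists k.
have Lu n : L2 (u n) by apply: ML2; have [] := Mu n.
have fast n p : (n <= p)%N -> nrm2 (fun t => u p t - u n t) <= 4 / 16 ^+ n.
  move=> np.
  have [Mn un] := Mu n; have [Mp up] := Mu p.
  (* the midpoint of u n and u p is in M, hence at distance at least d *)
  have := nrm2_parallelogram (L2B Lf (Lu n)) (L2B Lf (Lu p)).
  have -> : (fun t => f t - u n t + (f t - u p t)) =
            (fun t => 2 * (f t - 2^-1 * (u n t + u p t))).
    by apply/funext => t; field.
  have -> : (fun t => f t - u n t - (f t - u p t)) = (fun t => u p t - u n t).
    by apply/funext => t; ring.
  have Mmid := MZ 2^-1 _ (MD _ _ Mn Mp).
  rewrite nrm2Z; last by apply: L2B => //; exact: ML2.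
  have -> : sqnorm (2 : C) = 4 :> R by rewrite /sqnorm /=; ring.
  have := dle _ Mmid; set a := nrm2 _; set b := nrm2 _ => da ab.
  have : 1 / 16 ^+ p <= 1 / 16 ^+ n :> R.
    by rewrite !div1r lef_pV2 ?posrE ?exprn_gt0 // ler_weXn2l // ler1n.
  move: un up; rewrite !div1r.
  by set en := (16 ^+ n)^-1; set ep := (16 ^+ p)^-1 => un up en_ep; lra.
have [h Lh uh] := L2_complete Lu fast.
exists h; split.
  apply: closed_subspace_adherent => // e e0.
  have [n hn] := geometric_small 4 e0.
  by exists (u n); [have [] := Mu n|exact: le_lt_trans (uh n) hn].
move=> k Mk; have Lk := ML2 _ Mk.
apply: sqnorm_eq0; apply/eqP; rewrite eq_le sqnorm_ge0 andbT leNgt.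
apply/negP => pos.
have [n hn] := geometric_small (10 * nrm2 k) pos.
move: hn; apply/negP; rewrite -leNgt.
have [Mn un] := Mu n.
have orth : sqnorm (inner_prod (fun t => f t - u n t) k) <= 1 / 16 ^+ n * nrm2 k.
  apply: almost_orthogonal => //; first exact: L2B.
  move=> c.
  have := dle _ (MD _ _ Mn (MZ c _ Mk)).
  rewrite (_ : (fun t => f t - (u n t + c * k t)) =
               (fun t => f t - u n t - c * k t)); first by move: un; lra.
  by apply/funext => t; ring.
have close : sqnorm (inner_prod (fun t => u n t - h t) k) <= 4 / 16 ^+ n * nrm2 k.
  apply: le_trans (cauchy_schwarz (L2B (Lu n) Lh) Lk) _.
  by rewrite ler_wpM2r // nrm2_ge0.
rewrite (_ : (fun t => f t - h t) =
  (fun t => (f t - u n t) + (u n t - h t))); last first.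
  by apply/funext => t; ring.
rewrite inner_prodDl //; [|exact: L2B..].
apply: le_trans (sqnormD_le _ _) _.
rewrite mulrAC; move: orth close; set a := sqnorm _; set b := sqnorm _.
rewrite div1r; set e := _^-1; set N := nrm2 k.
by move=> h1 h2; lra.
Qed.

(** * Trigonometric polynomials and the Bessel inequality *)

Lemma sqnorm_eit t : sqnorm (eit t) = 1.
Proof. by rewrite /sqnorm /= cos2Dsin2. Qed.

Lemma eit_neq0 t : eit t != 0.
Proof.
apply/eqP => e0; have := sqnorm_eit t.
by rewrite e0 /sqnorm /= expr0n addr0 => /eqP; rewrite eq_sym oner_eq0.
Qed.

Lemma eitX t n : eit t ^+ n = eit (n%:R * t).
Proof.
elim: n => [|n IH]; first by rewrite expr0 mul0r /eit cos0 sin0.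
rewrite exprS IH /eit -natr1 mulrDl mul1r addrC cosD sinD; simpc.
by congr (_ +i* _); ring.
Qed.

Lemma cmeasurable_eit : cmeasurable (@eit R).
Proof.
split; apply: continuous_measurable_fun => t.
  exact: continuous_cos.
exact: continuous_sin.
Qed.

Lemma circle_measureE (h : R -> R) : measurable_fun setT h ->
  (forall t, 0 <= h t) ->
  (\int[m]_t (h t)%:E =
   ((pi *+ 2 - 0)^-1)%R%:E *
   \int[lebesgue_measure]_(t in `[0%R, (pi *+ 2)%R]) (h t)%:E)%E.
Proof.
move=> mh h0.
by apply: integral_uniform => [|t]; [exact/measurable_EFinP|rewrite lee_fin].
Qed.

(** Adding [1] makes the integrand nonnegative, as [circle_measureE] requires. *)
Lemma circle_mean_derivative (h H : R -> R) : continuous h ->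
  (forall t, `|h t| <= 1) -> (forall t, is_derive t 1 H (h t)) ->
  H (pi *+ 2) = H 0 -> (\int[m]_t h t)%R = 0.
Proof.
move=> ch h1 dH HE.
have mh : measurable_fun [set: measurableTypeR R] h.
  exact: continuous_measurable_fun.
have Ih : m.-integrable [set: measurableTypeR R] (EFin \o h).
  apply: measurable_bounded_integrable => //; first exact: circle_measure_lty.
  by exists 1; split => // x x1 t _; exact: le_trans (h1 t) (ltW x1).
have I1 : m.-integrable [set: measurableTypeR R] (EFin \o (fun=> 1)).
  exact: finite_measure_integrable_cst.
have : (\int[m]_t (h t + 1))%R = 1.
  rewrite /Rintegral circle_measureE.
  - rewrite (@continuous_FTC2 _ _ (fun t => H t + t)).
    + rewrite HE -EFinB -EFinM /= subr0.
      rewrite [X in _ * X = _](_ : _ = pi *+ 2); last by ring.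
      by rewrite mulVf // gt_eqF // zero_lt_2pi.
    + exact: zero_lt_2pi.
    + apply: continuous_subspaceT => t.
      by apply: cvgD; [exact: ch|exact: cvg_cst].
    + have dH1 t : is_derive t 1 (fun t => H t + t) (h t + 1).
        exact: is_deriveD.
      have cH t : {for t, continuous (fun t => H t + t)}.
        by apply: differentiable_continuous; apply/derivable1_diffP.
      split.
      * by move=> t _; have [] := dH1 t.
      * exact/cvg_at_right_filter/cH.
      * exact/cvg_at_left_filter/cH.
    + by move=> t _; rewrite derive1E; apply: derive_val.
  - by apply: measurable_funD.
  - by move=> t; have := h1 t; rewrite ler_norml => /andP[]; rewrite -subr_ge0 opprK.
rewrite RintegralD // Rintegral_cst // mul1r.
rewrite [X in _ + fine X](_ : _ = 1%E) /=; last exact: circle_measureT.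
by move=> /eqP; rewrite -[X in _ == X]add0r (inj_eq (addIr _)) => /eqP.
Qed.

Lemma circle_int_eitX n : (0 < n)%N -> circle_int (fun t => eit t ^+ n) = 0 :> C.
Proof.
move=> n0.
have nn0 : n%:R != 0 :> R by rewrite pnatr_eq0 -lt0n.
have dn t : is_derive t 1 (fun t : R => n%:R * t) n%:R.
  by apply: is_derive_eq; rewrite /GRing.scale /= mulr1.
have cn : continuous (fun t : R => n%:R * t).
  by move=> t; apply: cvgM; [exact: cvg_cst|exact: cvg_id].
have per : eit (n%:R * (pi *+ 2)) = eit (n%:R * 0) :> C.
  by rewrite -!eitX /eit cos0 sin0 cos2pi sin2pi.
rewrite /circle_int; congr (_ +i* _).
  under eq_Rintegral => t _ do rewrite eitX /=.
  apply: (@circle_mean_derivative _ (fun t => n%:R^-1 * sin (n%:R * t))).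
  - by move=> t; apply: continuous_comp; [exact: cn|exact: continuous_cos].
  - by move=> t; exact: cos_max.
  - move=> t.
    have d := is_derive1_comp (is_derive_sin (n%:R * t)) (dn t).
    have := is_deriveZ n%:R^-1 d; rewrite /GRing.scale /=.
    by rewrite mulrCA mulVf // mulr1.
  - by have := congr1 Im per => /= ->.
under eq_Rintegral => t _ do rewrite eitX /=.
apply: (@circle_mean_derivative _ (fun t => - n%:R^-1 * cos (n%:R * t))).
- by move=> t; apply: continuous_comp; [exact: cn|exact: continuous_sin].
- by move=> t; exact: sin_max.
- move=> t.
  have d := is_derive1_comp (is_derive_cos (n%:R * t)) (dn t).
  have := is_deriveZ (- n%:R^-1) d; rewrite /GRing.scale /=.
  by rewrite (_ : - n%:R^-1 * (- sin (n%:R * t) * n%:R) = sin (n%:R * t)) //; field.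
- by have := congr1 Re per => /= ->.
Qed.

Implicit Types (p q : {poly C}).

Definition circle_poly (p : {poly C}) : circle_fun := fun t => p.[eit t].

Lemma circle_polyMX p : circle_poly (p * 'X) = (fun t => circle_poly p t * eit t).
Proof. by apply/funext => t; rewrite /circle_poly hornerMX. Qed.

Lemma circle_polyD p q :
  circle_poly (p + q) = (fun t => circle_poly p t + circle_poly q t).
Proof. by apply/funext => t; rewrite /circle_poly hornerD. Qed.

Lemma circle_polyB p q :
  circle_poly (p - q) = (fun t => circle_poly p t - circle_poly q t).
Proof. by apply/funext => t; rewrite /circle_poly hornerD hornerN. Qed.

Lemma circle_polyZ c p : circle_poly (c *: p) = (fun t => c * circle_poly p t).
Proof. by apply/funext => t; rewrite /circle_poly hornerZ. Qed.

Lemma circle_polyC c : circle_poly c%:P = (fun=> c).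
Proof. by apply/funext => t; rewrite /circle_poly hornerC. Qed.

Lemma circle_polyXn n : circle_poly 'X^n = (fun t => eit t ^+ n).
Proof. by apply/funext => t; rewrite /circle_poly hornerXn. Qed.

Lemma L2_eit_mul f : L2 f -> L2 (fun t => eit t * f t).
Proof.
apply: (L2_mul_bounded (B := 1)); first exact: cmeasurable_eit.
by apply: ae_all => t; rewrite sqnorm_eit.
Qed.

Lemma L2_circle_poly p : L2 (circle_poly p).
Proof.
elim/poly_ind: p => [|p c Lp]; first by rewrite circle_polyC; exact: L2_cst.
rewrite circle_polyD circle_polyC circle_polyMX; apply: L2D (L2_cst c).
by have := L2_eit_mul Lp; congr (L2 _); apply/funext => t; rewrite mulrC.
Qed.

Lemma L2_eitX n : L2 (fun t => eit t ^+ n : C).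
Proof. by rewrite -circle_polyXn; exact: L2_circle_poly. Qed.

Lemma L2_cintegrable f : L2 f -> cintegrable f.
Proof.
move=> Lf; have := L2_mul_conj_integrable Lf (L2_cst 1).
by congr cintegrable; apply/funext => t; rewrite rmorph1 mulr1.
Qed.

Definition fourier f n : C := inner_prod f (fun t => eit t ^+ n).

Lemma fourierD f g n : L2 f -> L2 g ->
  fourier (fun t => f t + g t) n = fourier f n + fourier g n.
Proof. by move=> Lf Lg; rewrite /fourier inner_prodDl //; exact: L2_eitX. Qed.

Lemma fourierB f g n : L2 f -> L2 g ->
  fourier (fun t => f t - g t) n = fourier f n - fourier g n.
Proof. by move=> Lf Lg; rewrite /fourier inner_prodBl //; exact: L2_eitX. Qed.

Lemma fourier0 f : fourier f 0 = circle_int f.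
Proof.
rewrite /fourier /inner_prod; congr circle_int.
by apply/funext => t; rewrite expr0 rmorph1 mulr1.
Qed.

Lemma eit_conj t : eit t * (eit t)^*%C = 1 :> C.
Proof. by rewrite mul_conj sqnorm_eit. Qed.

Lemma eitV t : (eit t)^-1 = (eit t)^*%C :> C.
Proof. by apply: (mulfI (eit_neq0 t)); rewrite eit_conj mulfV // eit_neq0. Qed.

Lemma fourierMX f n : fourier (fun t => eit t * f t) n.+1 = fourier f n.
Proof.
rewrite /fourier /inner_prod; congr circle_int; apply/funext => t.
by rewrite exprS conjM mulrACA eit_conj mul1r.
Qed.

Lemma circle_int_eit_mul_poly p : circle_int (fun t => eit t * circle_poly p t) = 0.
Proof.
suff h n : (0 < n)%N -> circle_int (fun t => eit t ^+ n * circle_poly p t) = 0.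
  exact: (h 1%N).
elim/poly_ind: p n => [|p c IH] n n0.
  rewrite (_ : (fun t => _) = (fun=> 0)) ?circle_int_cst //.
  by apply/funext => t; rewrite circle_polyC mulr0.
rewrite (_ : (fun t => _) =
    (fun t => eit t ^+ n.+1 * circle_poly p t + c * eit t ^+ n)); last first.
  by apply/funext => t; rewrite circle_polyD circle_polyMX circle_polyC exprSr; ring.
have Iz : cintegrable (fun t => eit t ^+ n).
  by apply: L2_cintegrable; exact: L2_eitX.
rewrite circle_intD.
- by rewrite IH // circle_intZ // circle_int_eitX // mulr0 addr0.
- have : L2 (circle_poly (p * 'X^(n.+1))%R) by exact: L2_circle_poly.
  move=> /L2_cintegrable; congr cintegrable.
  by apply/funext => t; rewrite /circle_poly hornerM hornerXn mulrC.
- by apply: L2_cintegrable; apply: L2Z; exact: L2_eitX.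
Qed.

Lemma fourier_poly p n : fourier (circle_poly p) n = p`_n.
Proof.
have shift q c : circle_poly (q * 'X + c%:P) =
    (fun t => eit t * circle_poly q t + c).
  apply/funext => t.
  by rewrite circle_polyD circle_polyMX circle_polyC mulrC.
have Lzp q : L2 (fun t => eit t * circle_poly q t).
  exact/L2_eit_mul/L2_circle_poly.
elim: n p => [|n IH] p; elim/poly_ind: p => [|p c _].
- by rewrite circle_polyC coef0 fourier0 circle_int_cst.
- rewrite shift fourierD //; last exact: L2_cst.
  by rewrite !fourier0 circle_int_eit_mul_poly circle_int_cst coefD coefMX coefC.
- rewrite (_ : circle_poly 0 = (fun t => eit t * circle_poly 0 t)).
    by rewrite fourierMX IH !coef0.
  by apply/funext => t; rewrite circle_polyC mulr0.
- rewrite shift fourierD //; last exact: L2_cst.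
  rewrite fourierMX IH coefD coefMX coefC /= addr0.
  rewrite (_ : fourier _ _ = 0) ?addr0 //.
  rewrite /fourier inner_prod_conj; [|exact: L2_eitX|exact: L2_cst].
  rewrite (_ : inner_prod _ _ = c^*%C * circle_int (fun t => eit t ^+ n.+1)).
    by rewrite circle_int_eitX // mulr0 rmorph0.
  rewrite -circle_intZ; last by apply: L2_cintegrable; exact: L2_eitX.
  by congr circle_int; apply/funext => t; rewrite mulrC.
Qed.

(** Induction on [N]: the remainder after [N] terms still has [fourier f N] as
    its coefficient of index [N], since the partial sum has degree less than
    [N]. *)
Lemma bessel_identity f N : L2 f ->
  nrm2 (fun t => f t - circle_poly (\poly_(n < N) fourier f n) t) =
  nrm2 f - \sum_(n < N) sqnorm (fourier f n).
Proof.
move=> Lf; elim: N => [|N IH].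
  rewrite big_ord0 subr0; congr nrm2; apply/funext => t.
  by rewrite poly_def big_ord0 circle_polyC subr0.
set p := \poly_(n < N) _ in IH *.
have -> : \poly_(n < N.+1) fourier f n = p + fourier f N *: 'X^N.
  by rewrite /p !poly_def big_ord_recr.
rewrite circle_polyD circle_polyZ circle_polyXn big_ord_recr /=.
rewrite (_ : (fun t => _) =
  (fun t => f t - circle_poly p t - fourier f N * eit t ^+ N)); last first.
  by apply/funext => t; rewrite opprD addrA.
have Lp := L2_circle_poly p.
have Lz : L2 (fun t => eit t ^+ N : C) by exact: L2_eitX.
rewrite nrm2_inner_prodB; [|exact: L2B|exact: L2Z].
rewrite nrm2Z // inner_prodZr //; last exact: L2B.
rewrite inner_prodBl // -/(fourier f N) -/(fourier (circle_poly p) N).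
rewrite fourier_poly coef_poly ltnn subr0.
rewrite [(fourier f N)^*%C * _]mulrC mul_conj /= IH.
have -> : nrm2 (fun t => eit t ^+ N) = 1.
  have -> : nrm2 (fun t => eit t ^+ N) = Re (fourier (circle_poly 'X^N) N).
    by rewrite circle_polyXn.
  by rewrite fourier_poly coefXn eqxx.
by ring.
Qed.

Lemma bessel_inequality f N : L2 f ->
  \sum_(n < N) sqnorm (fourier f n) <= nrm2 f.
Proof. by move=> Lf; rewrite -subr_ge0 -bessel_identity // nrm2_ge0. Qed.

Lemma nrm2_poly p N : (size p <= N)%N ->
  nrm2 (circle_poly p) = \sum_(n < N) sqnorm p`_n.
Proof.
move=> pN; have Lp := L2_circle_poly p; apply/eqP; rewrite -subr_eq0; apply/eqP.
have -> : \sum_(n < N) sqnorm p`_n = \sum_(n < N) sqnorm (fourier (circle_poly p) n).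
  by apply: eq_bigr => n _; rewrite fourier_poly.
rewrite -bessel_identity //.
have -> : \poly_(n < N) fourier (circle_poly p) n = p.
  apply/polyP => n; rewrite coef_poly fourier_poly; case: ltnP => // Nn.
  by rewrite nth_default // (leq_trans pN).
by rewrite -circle_polyB subrr circle_polyC nrm2_0.
Qed.

(** * H2 as the closure of the polynomials *)

Lemma sqnormX z n : sqnorm (z ^+ n) = sqnorm z ^+ n.
Proof.
elim: n => [|n IH]; last by rewrite !exprS sqnormM IH.
by rewrite /sqnorm /= expr0n expr1n addr0.
Qed.

Lemma sqnorm_real (r : R) : sqnorm r%:C = r ^+ 2.
Proof. by rewrite /sqnorm /= expr0n addr0. Qed.

Lemma normc_real_eit (r : R) t : 0 <= r -> normc (r%:C * eit t) = r.
Proof.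
move=> r0; apply/eqP; rewrite -(@eqrXn2 _ 2) ?normc_ge0 //.
by rewrite normc_sqr sqnormM sqnorm_eit mulr1 sqnorm_real.
Qed.

Lemma Re_le_normc z : `|Re z| <= normc z.
Proof.
rewrite -ler_sqr ?nnegrE ?normc_ge0 // real_normK ?num_real //.
by rewrite normc_sqr lerDl sqr_ge0.
Qed.

Lemma Im_le_normc z : `|Im z| <= normc z.
Proof.
rewrite -ler_sqr ?nnegrE ?normc_ge0 // real_normK ?num_real //.
by rewrite normc_sqr lerDr sqr_ge0.
Qed.

Lemma normc_le z : normc z <= `|Re z| + `|Im z|.
Proof.
rewrite -ler_sqr ?nnegrE ?normc_ge0 ?addr_ge0 // normc_sqr /sqnorm.
rewrite -(real_normK (num_real (Re z))) -(real_normK (num_real (Im z))).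
have := mulr_ge0 (normr_ge0 (Re z)) (normr_ge0 (Im z)).
by rewrite sqrrD; set a := `|_|; set b := `|_| => ab; lra.
Qed.

Lemma ccvgP (a : nat -> C) z :
  ccvg a z <-> (normc (z - a n) @[n --> \oo] --> (0 : R)).
Proof.
split=> [[/cvgrPdist_lt h1 /cvgrPdist_lt h2]|/cvgr0Pnorm_lt h].
  apply/cvgr0Pnorm_lt => e e0.
  have e20 : 0 < e / 2 by rewrite divr_gt0.
  apply: filterS2 (h1 _ e20) (h2 _ e20) => n; rewrite -ReB -ImB => n1 n2.
  rewrite ger0_norm ?normc_ge0 //; apply: le_lt_trans (normc_le _) _.
  by rewrite [e]splitr ltrD.
split; apply/cvgrPdist_lt => e /h; apply: filterS => n;
  rewrite ger0_norm ?normc_ge0 //; apply: le_lt_trans.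
  by rewrite -ReB Re_le_normc.
by rewrite -ImB Im_le_normc.
Qed.

Definition dilate_poly (a : nat -> C) (r : R) N : {poly C} :=
  \poly_(n < N) (a n * r%:C ^+ n).

Lemma circle_dilate_poly a r N t :
  circle_poly (dilate_poly a r N) t = \sum_(n < N) a n * (r%:C * eit t) ^+ n.
Proof.
rewrite /circle_poly horner_poly; apply: eq_bigr => n _.
by rewrite exprMn mulrA.
Qed.

Section Dilates.
Variables (a : nat -> C) (F : C -> C) (r : R).
Hypothesis Fa : forall w : C, normc w < 1 ->
  (fun N : nat => normc (F w - \sum_(k < N) a k * w ^+ k)) @ \oo --> (0 : R).
Hypotheses (r0 : 0 <= r) (r1 : r < 1).

Let Fr : circle_fun := fun t => F (r%:C * eit t).

Lemma dilate_ccvg t : ccvg (fun N => circle_poly (dilate_poly a r N) t) (Fr t).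
Proof.
have /Fa : normc (r%:C * eit t) < 1 by rewrite normc_real_eit.
by move=> h; apply/ccvgP; under eq_fun do rewrite circle_dilate_poly.
Qed.

Lemma cmeasurable_dilate : cmeasurable Fr.
Proof.
have mp N : cmeasurable (circle_poly (dilate_poly a r N)).
  exact/L2_cmeasurable/L2_circle_poly.
split.
  apply: (@measurable_fun_cvg _ _ _ _
    (fun N t => Re (circle_poly (dilate_poly a r N) t))).
    by move=> N; have [] := mp N.
  by move=> t _; have [] := dilate_ccvg t.
apply: (@measurable_fun_cvg _ _ _ _
  (fun N t => Im (circle_poly (dilate_poly a r N) t))).
  by move=> N; have [] := mp N.
by move=> t _; have [] := dilate_ccvg t.
Qed.

(** The Taylor polynomials of the dilate converge to it pointwise, so by Fatou's
    lemma a bound on their distances to [q] carries over to the dilate. *)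
Lemma nrm2_dilateB q (B : R) N0 :
  (forall N, (N0 <= N)%N ->
    \sum_(n < N) sqnorm (a n * r%:C ^+ n - q`_n) <= B) ->
  L2 Fr /\ nrm2 (fun t => Fr t - circle_poly q t) <= B.
Proof.
move=> qB.
have Lq := L2_circle_poly q.
have mFq : cmeasurable (fun t => Fr t - circle_poly q t).
  apply: cmeasurableD; first exact: cmeasurable_dilate.
  exact/cmeasurableN/L2_cmeasurable.
pose N1 := maxn N0 (size q).
have eB : (energy (fun t => (Fr t - circle_poly q t)%R) <= B%:E)%E.
  apply: (energy_fatou
    (F := fun N => circle_poly (dilate_poly a r (N1 + N)%N - q))) => //.
  - by move=> N; exact/L2_cmeasurable/L2_circle_poly.
  - apply: ae_all => t.
    rewrite (_ : (fun N => _) = fun N =>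
      circle_poly (dilate_poly a r (N1 + N)%N) t - circle_poly q t); last first.
      by apply/funext => N; rewrite circle_polyB.
    by apply: ccvgBr; exact: (ccvg_shift N1 (dilate_ccvg t)).
  - move=> N; rewrite energyE; last exact: L2_circle_poly.
    rewrite lee_fin (@nrm2_poly _ (N1 + N)%N).
      apply: le_trans (qB (N1 + N)%N _).
        apply: ler_sum => n _; rewrite coefB coef_poly ltn_ord //.
      exact: leq_trans (leq_maxl N0 _) (leq_addr _ _).
    apply: (leq_trans (size_polyD _ _)); rewrite geq_max size_poly /= size_polyN.
    exact: leq_trans (leq_maxr N0 _) (leq_addr _ _).
have LFq : L2 (fun t => Fr t - circle_poly q t).
  by apply/L2P; split => //; apply: le_lt_trans eB _; rewrite ltry.
split; last by rewrite -lee_fin -energyE.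
have := L2D LFq Lq; congr (L2 _).
by apply/funext => t; rewrite subrK.
Qed.

End Dilates.

Lemma sqnorm_dilate_coef_le z (r : R) n : 0 <= r -> r < 1 ->
  sqnorm (z * r%:C ^+ n) <= sqnorm z.
Proof.
move=> r0 r1; rewrite sqnormM sqnormX sqnorm_real ler_piMr ?sqnorm_ge0 //.
by rewrite exprn_ile1 ?sqr_ge0 // exprn_ile1 // ltW.
Qed.

(** The boundary function of [F] is a limit of the dilates of [F], and these are
    limits of polynomials; all of them have the same mean [a 0]. *)
Lemma boundary_fun_approx (a : nat -> C) (F : C -> C) f :
  cvgn (series (fun n => normc (a n) ^+ 2)) ->
  (forall w : C, normc w < 1 ->
    (fun N : nat => normc (F w - \sum_(k < N) a k * w ^+ k)) @ \oo --> (0 : R)) ->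
  boundary_fun F f ->
  forall e : R, 0 < e ->
    exists2 p : {poly C}, p`_0 = a 0%N & nrm2 (fun t => circle_poly p t - f t) < e.
Proof.
move=> acv Fa [Lf Ff] e e0.
pose S N : R := \sum_(n < N) sqnorm (a n).
have SE : series (fun n => normc (a n) ^+ 2) = S.
  apply/funext => N; rewrite /series /= big_mkord.
  by apply: eq_bigr => n _; rewrite normc_sqr.
rewrite SE in acv.
have SS N : S N.+1 = S N + sqnorm (a N) by rewrite /S big_ord_recr.
have Sle N : S N <= limn S.
  apply: nondecreasing_cvgn_le => //; apply/nondecreasing_seqP => n.
  by rewrite SS lerDl sqnorm_ge0.
have LFr (r : R) : 0 <= r -> r < 1 -> L2 (fun t => F (r%:C * eit t)).
  move=> r0 r1; have [] // := @nrm2_dilateB a F r Fa r0 r1 0 (limn S) 0.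
  move=> N _; apply: le_trans (Sle N); apply: ler_sum => n _.
  by rewrite coef0 subr0 sqnorm_dilate_coef_le.
have nr : \forall r \near (1 : R)^'-, 0 <= r /\ r < 1.
  near=> r; split; last by near: r; exact: nbhs_left_lt.
  by apply: ltW; near: r; exact: nbhs_left_gt.
have nL : \forall r \near (1 : R)^'-, L2 (fun t => F (r%:C * eit t) - f t).
  by apply: filterS nr => r [r0 r1]; apply: L2B => //; exact: LFr.
have e40 : 0 < e / 4 by rewrite divr_gt0.
have Fe : \forall r \near (1 : R)^'-, nrm2 (fun t => F (r%:C * eit t) - f t) < e / 4.
  exact: (proj1 (norm_L2_cvg0P _ nL)).
have [r [[r0 r1] Fre]] := filter_ex (filterI nr Fe).
have [N SN] : exists N, limn S - S N < e / 4.
  have /cvgrPdist_lt/(_ _ e40)[N _ /(_ N (leqnn N)) h] := acv.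
  by exists N; exact: le_lt_trans (ler_norm _) h.
(* N.+1 rather than N, so that the coefficient of index 0 is not cut off *)
pose p := dilate_poly a r N.+1.
have tail j : \sum_(n < N.+1 + j) sqnorm (a n * r%:C ^+ n - p`_n) <=
    S (N.+1 + j)%N - S N.+1.
  elim: j => [|j IH].
    rewrite addn0 subrr big1 // => n _.
    by rewrite coef_poly ltn_ord subrr /sqnorm /= expr0n addr0.
  have pj : p`_(N.+1 + j) = 0.
    by rewrite nth_default // (leq_trans (size_poly _ _)) // leq_addr.
  rewrite addnS big_ord_recr SS addrAC; apply: lerD; first exact: IH.
  have := sqnorm_dilate_coef_le (a (N.+1 + j)%N) (N.+1 + j) r0 r1.
  by rewrite -[X in sqnorm X <= _]subr0 -{1}pj.
have [|LF Fp] := @nrm2_dilateB a F r Fa r0 r1 p (limn S - S N.+1) N.+1.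
  by move=> N' /subnKC <-; apply: le_trans (tail _) _; rewrite lerD2r.
exists p; first by rewrite coef_poly expr0 mulr1.
rewrite (_ : (fun t => _) =
  (fun t => (F (r%:C * eit t) - f t) - (F (r%:C * eit t) - circle_poly p t))).
  apply: le_lt_trans (nrm2B_le _ _) _.
  - exact: L2B.
  - by apply: L2B => //; exact: L2_circle_poly.
  - have : S N <= S N.+1 by rewrite SS lerDl sqnorm_ge0.
    by move: Fre Fp; set x := nrm2 _; set y := nrm2 _; lra.
by apply/funext => t; ring.
Unshelve. all: by end_near. Qed.

(** The extension to the disc is a choice, but its value at 0 is the common mean
    of the approximating polynomials, hence the mean of [f]. *)
Lemma boundary_fun_mean (a : nat -> C) (F : C -> C) f :
  cvgn (series (fun n => normc (a n) ^+ 2)) ->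
  (forall w : C, normc w < 1 ->
    (fun N : nat => normc (F w - \sum_(k < N) a k * w ^+ k)) @ \oo --> (0 : R)) ->
  boundary_fun F f -> F 0 = circle_int f.
Proof.
move=> acv Fa Ff; have [Lf _] := Ff.
have F0 : F 0 = a 0%N.
  have n0 : normc (0 : C) < 1 by rewrite /= expr0n /= addr0 sqrtr0.
  have /(ccvg_shift 1) := proj2 (ccvgP _ _) (Fa 0 n0).
  rewrite (_ : (fun N => _) = (fun=> a 0%N)).
    move=> [c1 c2].
    have e1 : Re (F 0) = Re (a 0%N) by apply: cvg_unique c1 (cvg_cst _).
    have e2 : Im (F 0) = Im (a 0%N) by apply: cvg_unique c2 (cvg_cst _).
    move: e1 e2; by case: (F 0) (a 0%N) => ? ? [? ?] /= -> ->.
  apply/funext => N; rewrite big_ord_recl expr0 mulr1 big1 ?addr0 // => k _.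
  by rewrite exprS mul0r mulr0.
rewrite F0; apply/eqP; rewrite eq_sym -subr_eq0; apply/eqP/sqnorm_eq0/eqP.
rewrite eq_le sqnorm_ge0 andbT leNgt; apply/negP => pos.
have [p p0 pf] := boundary_fun_approx acv Fa Ff pos.
have Lp := L2_circle_poly p.
move: pf; apply/negP; rewrite -leNgt -p0 -fourier0 -fourier_poly -fourierB //.
rewrite nrm2_distC //; have := bessel_inequality 1 (L2B Lf Lp).
by rewrite big_ord1.
Qed.

Lemma disc_ext0 f : H2 f -> disc_ext f 0 = circle_int f.
Proof.
move=> [F FP]; rewrite /disc_ext; case: xgetP => [G _ [[a [acv aG]] bG]|noF].
  exact: boundary_fun_mean acv aG bG.
by case: (noF F).
Qed.

Lemma H2_adherent f : H2 f -> adherent (range circle_poly) f.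
Proof.
move=> [F [[a [acv Fa]] bF]] e e0.
by have [p _ pf] := boundary_fun_approx acv Fa bF e0; exists (circle_poly p).
Qed.

Lemma power_series_cvg (a : nat -> C) (B : R) :
  (forall N, \sum_(n < N) sqnorm (a n) <= B) ->
  forall w : C, normc w < 1 ->
    exists z, ccvg (fun N => \sum_(n < N) a n * w ^+ n) z.
Proof.
move=> aB w w1.
have B0 : 0 <= B by apply: le_trans (aB 0%N); rewrite big_ord0.
have an n : normc (a n) <= Num.sqrt B.
  rewrite -ler_sqr ?nnegrE ?normc_ge0 ?sqrtr_ge0 // sqr_sqrtr // normc_sqr.
  apply: le_trans (aB n.+1); rewrite big_ord_recr /= lerDr.
  by apply: sumr_ge0 => k _; exact: sqnorm_ge0.
have nX n : normc (w ^+ n) = normc w ^+ n.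
  elim: n => [|n IH]; last by rewrite !exprS Normc.normcM IH.
  by rewrite !expr0 /= expr0n expr1n addr0 sqrtr1.
have cv (u : nat -> R) : (forall n, `|u n| <= normc (a n * w ^+ n)) ->
    cvgn (series u).
  move=> h; apply: normed_cvg.
  apply: (@series_le_cvg _ _ (geometric (Num.sqrt B) (normc w))) => //=.
  - by move=> n; rewrite mulr_ge0 ?sqrtr_ge0 // exprn_ge0 // normc_ge0.
  - move=> n; apply: le_trans (h n) _.
    by rewrite Normc.normcM nX ler_wpM2r // exprn_ge0 // normc_ge0.
  - by apply: is_cvg_geometric_series; rewrite ger0_norm // normc_ge0.
have cRe := cv _ (fun n => Re_le_normc (a n * w ^+ n)).
have cIm := cv _ (fun n => Im_le_normc (a n * w ^+ n)).
have ReE N : Re (\sum_(n < N) a n * w ^+ n) = series (fun n => Re (a n * w ^+ n)) N.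
  rewrite /series /= big_mkord; apply: (big_morph Re) => // x y.
  by case: x y => ? ? [].
have ImE N : Im (\sum_(n < N) a n * w ^+ n) = series (fun n => Im (a n * w ^+ n)) N.
  rewrite /series /= big_mkord; apply: (big_morph Im) => // x y.
  by case: x y => ? ? [].
exists (limn (series (fun n => Re (a n * w ^+ n))) +i*
        limn (series (fun n => Im (a n * w ^+ n)))); split.
  by under eq_fun do rewrite ReE.
by under eq_fun do rewrite ImE.
Qed.

Lemma nrm2_dilate_poly_cvg0 p :
  (fun r : R => \sum_(n < size p) sqnorm (p`_n * r%:C ^+ n - p`_n)) @ (1 : R)^'-
  --> (0 : R).
Proof.
rewrite (_ : (fun r => _) =
    (fun r => \sum_(n < size p) sqnorm p`_n * (r ^+ n - 1) ^+ 2)); last first.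
  apply/funext => r; apply: eq_bigr => n _.
  rewrite -[X in _ - X]mulr1 -mulrBr sqnormM -rmorphXn.
  by rewrite -(rmorph1 (real_complex R)) -rmorphB sqnorm_real.
apply: cvg_at_left_filter.
elim: (size p) => [|N IH].
  by under eq_fun do rewrite big_ord0; exact: cvg_cst.
under eq_fun do rewrite big_ord_recr /=.
have h : (fun r : R => sqnorm p`_N * (r ^+ N - 1) ^+ 2) @ (1 : R) -->
    sqnorm p`_N * (1 ^+ N - 1) ^+ 2.
  have hN : (fun r : R => r ^+ N - 1) @ (1 : R) --> (1 ^+ N - 1 : R).
    by apply: cvgB; [exact: exprn_continuous|exact: cvg_cst].
  by apply: cvgM; [exact: cvg_cst|rewrite expr2; exact: (cvgM hN hN)].
rewrite expr1n subrr expr0n mulr0 in h.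
by have := cvgD IH h; rewrite addr0; apply.
Qed.

(** The function with Taylor coefficients [fourier f] is controlled by Bessel's
    inequality: its dilates depend on [f] in a contractive way, so it suffices
    to see the dilates of a polynomial converge. *)
Lemma adherent_H2 f : L2 f -> adherent (range circle_poly) f -> H2 f.
Proof.
move=> Lf fp; pose a := fourier f.
have aB N : \sum_(n < N) sqnorm (a n) <= nrm2 f by exact: bessel_inequality.
pose F (w : C) : C := xget 0 [set z | ccvg (fun N => \sum_(n < N) a n * w ^+ n) z].
have Fa (w : C) : normc w < 1 ->
    normc (F w - \sum_(n < N) a n * w ^+ n) @[N --> \oo] --> (0 : R).
  move=> w1; apply/ccvgP; have [z wz] := power_series_cvg aB w1.
  by rewrite /F; case: xgetP => // /(_ z).
exists F; split.
  exists a; split=> //.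
  apply: nondecreasing_is_cvgn.
    by apply/nondecreasing_seqP => n; rewrite seriesSr lerDl exprn_ge0 // normc_ge0.
  exists (nrm2 f) => _ [N _ <-].
  rewrite (_ : series _ N = \sum_(n < N) sqnorm (a n)) //.
  by rewrite seriesEord; apply: eq_bigr => n _; rewrite normc_sqr.
split=> //.
have contract p (r : R) : 0 <= r -> r < 1 -> L2 (fun t => F (r%:C * eit t)) /\
    nrm2 (fun t => F (r%:C * eit t) -
      circle_poly (dilate_poly (fun n => p`_n) r (size p)) t) <=
    nrm2 (fun t => circle_poly p t - f t).
  move=> r0 r1; apply: (@nrm2_dilateB a F r Fa r0 r1 _ _ 0) => N _.
  have Lp := L2_circle_poly p.
  rewrite nrm2_distC //; apply: le_trans (bessel_inequality N (L2B Lf Lp)).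
  apply: ler_sum => n _; rewrite fourierB // fourier_poly coef_poly.
  rewrite (_ : _ - _ = (a n - p`_n) * r%:C ^+ n) ?sqnorm_dilate_coef_le //.
  rewrite mulrBl; congr (_ - _); case: ltnP => // pn.
  by rewrite nth_default // mul0r.
have nr : \forall r \near (1 : R)^'-, 0 <= r /\ r < 1.
  near=> r; split; last by near: r; exact: nbhs_left_lt.
  by apply: ltW; near: r; exact: nbhs_left_gt.
have LFr (r : R) : 0 <= r -> r < 1 -> L2 (fun t => F (r%:C * eit t)).
  by move=> r0 r1; have [] := contract 0 r r0 r1.
apply/norm_L2_cvg0P.
  by apply: filterS nr => r [r0 r1]; apply: L2B => //; exact: LFr.
move=> e e0; have e20 : 0 < e / 20 by rewrite divr_gt0.
have [_ [p _ <-] pf] := fp _ e20.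
have Lp := L2_circle_poly p.
have /cvgr0Pnorm_lt/(_ _ e20) pr := nrm2_dilate_poly_cvg0 p.
apply: filterS2 nr pr => r [r0 r1].
set q := dilate_poly (fun n => p`_n) r (size p).
have Lq := L2_circle_poly q.
have qp : nrm2 (fun t => circle_poly q t - circle_poly p t) =
    \sum_(n < size p) sqnorm (p`_n * r%:C ^+ n - p`_n).
  rewrite -circle_polyB (@nrm2_poly _ (size p)).
    by apply: eq_bigr => n _; rewrite coefB coef_poly ltn_ord.
  by rewrite (leq_trans (size_polyD _ _)) // size_polyN geq_max size_poly leqnn.
rewrite -qp ger0_norm ?nrm2_ge0 // => qpe.
have [_] := contract p r r0 r1; rewrite -/q => Fq.
have LF := LFr r r0 r1.
rewrite (_ : (fun t => _) = (fun t => (F (r%:C * eit t) - circle_poly q t) +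
  ((circle_poly q t - circle_poly p t) + (circle_poly p t - f t)))); last first.
  by apply/funext => t; ring.
have L1 := L2B LF Lq; have L3 := L2B Lq Lp; have L4 := L2B Lp Lf.
apply: le_lt_trans (nrm2D_le L1 (L2D L3 L4)) _.
have := nrm2D_le L3 L4; move: Fq qpe pf.
set x1 := nrm2 _; set x2 := nrm2 _; set x3 := nrm2 _; set x4 := nrm2 _.
by move=> *; lra.
Unshelve. all: by end_near. Qed.

(** From here on closure properties of H2 are checked on polynomials. *)
Lemma H2P f : H2 f <-> L2 f /\ adherent (range circle_poly) f.
Proof.
split=> [Hf|[Lf]]; last exact: adherent_H2.
by split; [have [F [_ []]] := Hf|exact: H2_adherent].
Qed.

(** * Multiplication and division by z in H2 *)

Lemma H2_L2 f : H2 f -> L2 f.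
Proof. by move=> /H2P[]. Qed.

Lemma closed_subspace_ae (M : set circle_fun) f g : closed_subspace M ->
  M f -> L2 g -> {ae m, forall t, f t = g t} -> M g.
Proof.
move=> CM Mf Lg fg; have [ML2 _ _ _ _] := CM.
apply: closed_subspace_adherent => // e e0; exists f => //.
rewrite (@nrm2_ae _ (fun=> 0)) ?nrm2_0 //.
- by apply: L2B => //; exact: ML2.
- exact: L2_cst.
- by apply: ae_imply fg => t ->; rewrite subrr.
Qed.

Lemma nrm2_scale_small c f : L2 f -> forall e : R, 0 < e ->
  nrm2 f < e / (sqnorm c + 1) -> nrm2 (fun t => c * f t) < e.
Proof.
move=> Lf e e0; have c0 := sqnorm_ge0 c.
rewrite ltr_pdivlMr ?ltr_wpDl // nrm2Z // mulrDr mulr1 mulrC.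
by apply: le_lt_trans; rewrite lerDl nrm2_ge0.
Qed.

Lemma H2_closed_subspace : closed_subspace (@H2 R).
Proof.
apply: adherent_closed_subspace.
- exact: H2_L2.
- apply/H2P; split; first exact: L2_cst.
  move=> e e0; exists (circle_poly 0); first by exists 0.
  rewrite (_ : (fun t => _) = circle_poly 0); last first.
    by apply/funext => t; rewrite subr0.
  by rewrite (@nrm2_poly _ 0) ?big_ord0 // size_poly0.
- move=> f g /H2P[Lf fp] /H2P[Lg gp]; apply/H2P; split; first exact: L2D.
  move=> e e0; have e40 : 0 < e / 4 by rewrite divr_gt0.
  have [_ [p _ <-] pf] := fp _ e40; have [_ [q _ <-] qg] := gp _ e40.
  exists (circle_poly (p + q)); first by exists (p + q).
  rewrite circle_polyD (_ : (fun t => _) =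
    (fun t => (circle_poly p t - f t) + (circle_poly q t - g t))); last first.
    by apply/funext => t; ring.
  have Lp := L2_circle_poly p; have Lq := L2_circle_poly q.
  apply: le_lt_trans (nrm2D_le (L2B Lp Lf) (L2B Lq Lg)) _.
  by move: pf qg; set x1 := nrm2 _; set x2 := nrm2 _ => *; lra.
- move=> c f /H2P[Lf fp]; apply/H2P; split; first exact: L2Z.
  move=> e e0.
  have [|_ [p _ <-] pf] := fp (e / (sqnorm c + 1)).
    by rewrite divr_gt0 // ltr_wpDl // sqnorm_ge0.
  exists (circle_poly (c *: p)); first by exists (c *: p).
  rewrite circle_polyZ (_ : (fun t => _) =
    (fun t => c * (circle_poly p t - f t))); last first.
    by apply/funext => t; rewrite mulrBr.
  by apply: nrm2_scale_small => //; apply: L2B => //; exact: L2_circle_poly.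
- move=> f Lf fp; apply/H2P; split=> // e e0.
  have e40 : 0 < e / 4 by rewrite divr_gt0.
  have [k /H2P[Lk kp] kf] := fp _ e40.
  have [_ [p _ <-] pk] := kp _ e40.
  have Lp := L2_circle_poly p.
  exists (circle_poly p); first by exists p.
  rewrite (_ : (fun t => _) =
    (fun t => (circle_poly p t - k t) + (k t - f t))); last first.
    by apply/funext => t; ring.
  apply: le_lt_trans (nrm2D_le (L2B Lp Lk) (L2B Lk Lf)) _.
  by move: kf pk; set x1 := nrm2 _; set x2 := nrm2 _ => *; lra.
Qed.

Lemma H2_cst c : H2 (fun=> c).
Proof.
apply/H2P; split; first exact: L2_cst.
move=> e e0; exists (circle_poly c%:P); first by exists c%:P.
rewrite circle_polyC (_ : (fun t => _) = (fun=> 0)) ?nrm2_0 //.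
by apply/funext => t; rewrite subrr.
Qed.

Lemma inner_prod_eit_mul f g :
  inner_prod (fun t => eit t * f t) (fun t => eit t * g t) = inner_prod f g.
Proof.
rewrite /inner_prod; congr circle_int; apply/funext => t.
by rewrite conjM mulrACA eit_conj mul1r.
Qed.

Lemma nrm2_eit_mul f : nrm2 (fun t => eit t * f t) = nrm2 f.
Proof. by rewrite /nrm2 inner_prod_eit_mul. Qed.

Lemma eitXS f n :
  (fun t => eit t ^+ n.+1 * f t) = (fun t => eit t * (eit t ^+ n * f t)).
Proof. by apply/funext => t; rewrite exprS mulrA. Qed.

Lemma eitX0 f : (fun t => eit t ^+ 0 * f t) = f.
Proof. by apply/funext => t; rewrite expr0 mul1r. Qed.

Lemma nrm2_eitX_mul f n : nrm2 (fun t => eit t ^+ n * f t) = nrm2 f.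
Proof.
by elim: n => [|n IH]; rewrite ?eitX0 // eitXS nrm2_eit_mul.
Qed.

Lemma L2_eitX_mul f n : L2 f -> L2 (fun t => eit t ^+ n * f t).
Proof.
by move=> Lf; elim: n => [|n IH]; rewrite ?eitX0 // eitXS; exact: L2_eit_mul.
Qed.

Lemma L2_div_eit f : L2 f -> L2 (fun t => f t / eit t).
Proof.
move=> Lf; have := L2_conj (L2_eit_mul (L2_conj Lf)); congr (L2 _).
by apply/funext => t; rewrite conjM conjcK eitV mulrC.
Qed.

Lemma H2_eit_mul f : H2 f -> H2 (fun t => eit t * f t).
Proof.
move=> /H2P[Lf fp]; apply/H2P; split; first exact: L2_eit_mul.
move=> e e0; have [_ [p _ <-] pf] := fp _ e0.
exists (circle_poly (p * 'X)); first by exists (p * 'X).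
rewrite circle_polyMX (_ : (fun t => _) =
  (fun t => eit t * (circle_poly p t - f t))) ?nrm2_eit_mul //.
by apply/funext => t; ring.
Qed.

Lemma H2_eitX_mul f n : H2 f -> H2 (fun t => eit t ^+ n * f t).
Proof.
by move=> Lf; elim: n => [|n IH]; rewrite ?eitX0 // eitXS; exact: H2_eit_mul.
Qed.

Lemma sqnorm_mean_le f : L2 f -> sqnorm (circle_int f) <= nrm2 f.
Proof.
by move=> Lf; have := bessel_inequality 1 Lf; rewrite big_ord1 fourier0.
Qed.

Lemma circle_intB f g : L2 f -> L2 g ->
  circle_int (fun t => f t - g t) = circle_int f - circle_int g.
Proof. by move=> Lf Lg; rewrite -!fourier0 fourierB. Qed.

(** [f / z] is the limit of [(p - p(0)) / z] when [f] is the limit of the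
    polynomials [p], because [p(0)] tends to the mean of [f]. *)
Lemma H2_div_eit f : H2 f -> circle_int f = 0 -> H2 (fun t => f t / eit t).
Proof.
move=> /H2P[Lf fp] f0; apply/H2P; split; first exact: L2_div_eit.
move=> e e0; have e40 : 0 < e / 4 by rewrite divr_gt0.
have [_ [p _ <-] pf] := fp _ e40.
have [q [c pE]] : exists q c, p = q * 'X + c%:P.
  elim/poly_ind: p {pf} => [|p c _]; last by exists p, c.
  by exists 0, 0; rewrite mul0r add0r.
exists (circle_poly q); first by exists q.
rewrite -nrm2_eit_mul (_ : (fun t => _) =
    (fun t => circle_poly p t - f t - c)); last first.
  apply/funext => t; rewrite pE circle_polyD circle_polyMX circle_polyC.
  by field; exact: eit_neq0.
have Lp := L2_circle_poly p.
have cE : c = circle_int (fun t => circle_poly p t - f t).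
  rewrite circle_intB // f0 subr0 -fourier0 fourier_poly pE.
  by rewrite coefD coefMX coefC add0r.
apply: le_lt_trans (nrm2B_le (L2B Lp Lf) (L2_cst c)) _.
have := sqnorm_mean_le (L2B Lp Lf); rewrite -cE nrm2_cst.
by move: pf; set x := nrm2 _ => *; lra.
Qed.

(** The mean is continuous on L2 and vanishes on [z p] for polynomials [p]. *)
Lemma circle_int_eit_mul f : H2 f -> circle_int (fun t => eit t * f t) = 0.
Proof.
move=> /H2P[Lf fp]; apply/sqnorm_eq0/eqP; rewrite eq_le sqnorm_ge0 andbT leNgt.
apply/negP => pos; have [_ [p _ <-] pf] := fp _ pos.
have Lp := L2_circle_poly p.
move: pf; apply/negP; rewrite -leNgt nrm2_distC // -nrm2_eit_mul.
rewrite (_ : circle_int _ =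
    circle_int (fun t => eit t * (f t - circle_poly p t))).
  by apply/sqnorm_mean_le/L2_eit_mul/L2B.
rewrite (_ : (fun t => eit t * (f t - _)) =
    (fun t => eit t * f t - eit t * circle_poly p t)).
  by rewrite circle_intB ?circle_int_eit_mul_poly ?subr0 //; exact: L2_eit_mul.
by apply/funext => t; rewrite mulrBr.
Qed.

Definition H20 : set circle_fun := [set f | H2 f /\ circle_int f = 0].

Lemma H20_closed_subspace : closed_subspace H20.
Proof.
have [HL2 H0 HD HZ _] := H2_closed_subspace.
apply: adherent_closed_subspace.
- by move=> f [/HL2].
- by split => //; rewrite circle_int_cst.
- move=> f g [Hf f0] [Hg g0]; split; first exact: HD.
  by rewrite circle_intD ?f0 ?g0 ?addr0 //; apply/L2_cintegrable/HL2.
- move=> c f [Hf f0]; split; first exact: HZ.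
  by rewrite circle_intZ ?f0 ?mulr0 //; apply/L2_cintegrable/HL2.
- move=> f Lf fp; split.
    apply: closed_subspace_adherent H2_closed_subspace Lf _ => e /fp.
    by move=> [k [Hk _] kf]; exists k.
  apply/sqnorm_eq0/eqP; rewrite eq_le sqnorm_ge0 andbT leNgt.
  apply/negP => /fp[k [/HL2 Lk k0]].
  apply/negP; rewrite -leNgt nrm2_distC //.
  by have := sqnorm_mean_le (L2B Lf Lk); rewrite circle_intB // k0 subr0.
Qed.

(** * The model space *)

Section Unimodular.
Variable theta : circle_fun.
Hypothesis mtheta : cmeasurable theta.
Hypothesis theta1 : {ae m, forall t, normc (theta t) = 1}.

Lemma theta_sqnorm : {ae m, forall t, sqnorm (theta t) = 1}.
Proof. by apply: ae_imply theta1 => t t1; rewrite -normc_sqr t1 expr1n. Qed.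

Lemma theta_conj : {ae m, forall t, theta t * (theta t)^*%C = 1}.
Proof. by apply: ae_imply theta_sqnorm => t t1; rewrite mul_conj t1. Qed.

(** On the model space this is, up to a factor [z], the usual conjugation. *)
Definition theta_flip f : circle_fun := fun t => theta t * (f t)^*%C.

Lemma L2_theta_flip f : L2 f -> L2 (theta_flip f).
Proof.
move=> /L2_conj; apply: (L2_mul_bounded (B := 1)) => //.
by apply: ae_imply theta_sqnorm => t ->.
Qed.

Lemma theta_flipK f : {ae m, forall t, theta_flip (theta_flip f) t = f t}.
Proof.
apply: ae_imply theta_conj => t t1.
by rewrite /theta_flip conjM conjcK mulrA t1 mul1r.
Qed.

Lemma theta_flipD f g :
  theta_flip (fun t => f t + g t) = (fun t => theta_flip f t + theta_flip g t).
Proof. by apply/funext => t; rewrite /theta_flip conjD mulrDr. Qed.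

Lemma theta_flipB f g :
  theta_flip (fun t => f t - g t) = (fun t => theta_flip f t - theta_flip g t).
Proof. by apply/funext => t; rewrite /theta_flip conjB mulrBr. Qed.

Lemma theta_flipZ c f :
  theta_flip (fun t => c * f t) = (fun t => c^*%C * theta_flip f t).
Proof. by apply/funext => t; rewrite /theta_flip conjM mulrCA. Qed.

Lemma nrm2_theta_flip f : L2 f -> nrm2 (theta_flip f) = nrm2 f.
Proof.
move=> Lf; congr (Re _); apply: circle_int_ae.
- by apply: cmeasurableM; [|apply: cmeasurable_conj];
    apply: L2_cmeasurable; exact: L2_theta_flip.
- by apply: cmeasurableM; [|apply: cmeasurable_conj]; exact: L2_cmeasurable.
- apply: ae_imply theta_sqnorm => t t1.
  by rewrite !mul_conj /theta_flip sqnormM t1 mul1r sqnorm_conj.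
Qed.

(** Almost everywhere [theta_flip] is an involution, and [f = theta conj(h)] says
    that [h] is the flip of [f]; this makes the two conditions defining the model space
    symmetric. *)
Lemma model_spaceP f :
  model_space theta f <-> H2 f /\ H20 (theta_flip f).
Proof.
split=> [[[Lf [_ [h [Hh h0] ->] fh] Hf]]|[Hf [Hg g0]]].
  split=> //.
  apply: (closed_subspace_ae (f := h) H20_closed_subspace).
  - by split=> //; rewrite -disc_ext0.
  - exact: L2_theta_flip.
  - apply: ae_imply2 fh theta_conj => t ft t1.
    by rewrite /theta_flip ft conjM conjcK mulrA t1 mul1r.
split=> //; split; first exact: H2_L2.
exists (fun t => (theta_flip f t)^*%C).
  by exists (theta_flip f) => //; rewrite disc_ext0.
by apply: ae_imply (theta_flipK f) => t {1}<-.
Qed.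

Lemma model_space_closed_subspace : closed_subspace (model_space theta).
Proof.
have [HL2 H0 HD HZ _] := H2_closed_subspace.
have [_ H200 H20D H20Z _] := H20_closed_subspace.
apply: adherent_closed_subspace.
- by move=> f /model_spaceP[/HL2].
- apply/model_spaceP; split=> //; congr H20: H200.
  by apply/funext => t; rewrite /theta_flip rmorph0 mulr0.
- move=> f g /model_spaceP[Hf f0] /model_spaceP[Hg g0]; apply/model_spaceP.
  by rewrite theta_flipD; split; [exact: HD|exact: H20D].
- move=> c f /model_spaceP[Hf f0]; apply/model_spaceP.
  by rewrite theta_flipZ; split; [exact: HZ|exact: H20Z].
- move=> f Lf fp; apply/model_spaceP; split.
    apply: closed_subspace_adherent H2_closed_subspace Lf _ => e /fp.
    by move=> [k /model_spaceP[Hk _] kf]; exists k.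
  apply: closed_subspace_adherent H20_closed_subspace (L2_theta_flip Lf) _.
  move=> e /fp[k /model_spaceP[/HL2 Lk Hk] kf]; exists (theta_flip k) => //.
  by rewrite -theta_flipB nrm2_theta_flip //; exact: L2B.
Qed.

(** Multiplication by [z] maps the model space into itself up to multiples of
    [theta]: with [w = theta_flip k], one has [z k = theta_flip (w / z)], and
    removing the mean of [w / z] amounts to subtracting a multiple of
    [theta]. *)
Lemma model_space_eit_mul k : H2 theta -> model_space theta k ->
  exists c, model_space theta (fun t => eit t * k t - c * theta t).
Proof.
move=> Ht /model_spaceP[Hk [Hw w0]].
pose w' t := theta_flip k t / eit t.
have Hw' : H2 w' by exact: H2_div_eit.
have [_ _ _ HZ _] := H2_closed_subspace.
exists (circle_int w')^*%C; apply/model_spaceP; split.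
  apply: closed_subspaceB H2_closed_subspace _ _; first exact: H2_eit_mul.
  exact: HZ.
apply: (closed_subspace_ae (f := fun t => w' t - circle_int w') H20_closed_subspace).
- split; first exact: closed_subspaceB H2_closed_subspace Hw' (H2_cst _).
  by rewrite circle_intB ?circle_int_cst ?subrr //; [exact: H2_L2|exact: L2_cst].
- apply: L2_theta_flip; apply: L2B; first exact/L2_eit_mul/H2_L2.
  exact/L2Z/H2_L2.
- apply: ae_imply theta_conj => t t1.
  rewrite theta_flipB theta_flipZ conjcK /w' /theta_flip t1 mulr1 eitV conjM.
  by congr (_ - _); ring.
Qed.

(** With [h = z^n f] one has [theta_flip f = z^n theta_flip h], which is in H2;
    its flip is [f], and removing the mean of [f] gives an element of the model
    space. This is the test element used on the kernel. *)
Lemma model_space_unshift f n : model_space theta (fun t => eit t ^+ n * f t) ->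
  H2 theta -> H2 f ->
  model_space theta (fun t => theta_flip f t - (circle_int f)^*%C * theta t).
Proof.
move=> /model_spaceP[_ [Hg _]] Ht Hf; apply/model_spaceP.
have [_ _ _ HZ _] := H2_closed_subspace.
have Htf : H2 (theta_flip f).
  have := H2_eitX_mul n Hg; congr H2; apply/funext => t.
  by rewrite /theta_flip conjM eitX mulrCA [eit _ * _]mulrA eit_conj mul1r.
split.
  by apply: closed_subspaceB H2_closed_subspace _ _ => //; exact: HZ.
apply: (closed_subspace_ae (f := fun t => f t - circle_int f) H20_closed_subspace).
- split; first exact: closed_subspaceB H2_closed_subspace Hf (H2_cst _).
  by rewrite circle_intB ?circle_int_cst ?subrr //; [exact: H2_L2|exact: L2_cst].
- by apply: L2_theta_flip; apply: L2B; [exact: H2_L2|exact/L2Z/H2_L2].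
- apply: ae_imply2 theta_conj (theta_flipK f) => t t1 tf.
  by rewrite theta_flipB theta_flipZ conjcK tf /theta_flip t1 mulr1.
Qed.

End Unimodular.

(** * The kernel of the truncated Toeplitz operator *)

(** The default value of [orth_proj] does no harm because the projection exists;
    this is where completeness of L2 enters. *)
Lemma orth_proj_ae0 (M : set circle_fun) x : closed_subspace M -> L2 x ->
  {ae m, forall t, orth_proj M x t = 0} <->
  (forall k, M k -> inner_prod x k = 0).
Proof.
move=> CM Lx; have [ML2 _ _ _ _] := CM; split=> [P0 k Mk|xM].
  have [|MP PM] := @xgetPex _ (fun=> 0)
    [set h | M h /\ forall k, M k -> inner_prod (fun t => x t - h t) k = 0].
    exact: projection_exists.
  rewrite -(PM _ Mk); apply: inner_prod_ae => //.
  - by apply: L2B => //; exact: ML2.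
  - exact: ML2.
  - exact: ML2.
  - by apply: ae_imply P0 => t; rewrite /orth_proj => ->; rewrite subr0.
  - exact: ae_all.
rewrite /orth_proj; case: xgetP => [h _ [Mh hM]|_]; last exact: ae_all.
have Lh := ML2 _ Mh; apply: nrm2_eq0 => //.
have := hM _ Mh; rewrite inner_prodBl // xM // sub0r inner_prod_self => /eqP.
by rewrite oppr_eq0 => /eqP [].
Qed.

Section Kernel.
Variables theta g : circle_fun.
Hypothesis Ht : H2 theta.
Hypothesis theta1 : {ae m, forall t, normc (theta t) = 1}.
Hypothesis Bg : Linfty g.

Let mtheta : cmeasurable theta.
Proof. exact/L2_cmeasurable/H2_L2. Qed.

Let K := model_space theta.
Let CK : closed_subspace K.
Proof. exact: model_space_closed_subspace. Qed.

Let KL2 f : K f -> L2 f.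
Proof. by have [+ _ _ _ _] := CK; apply. Qed.

Lemma ker_toeplitzP f : ker_toeplitz theta g f <->
  K f /\ forall k, K k -> inner_prod (fun t => g t * f t) k = 0.
Proof.
split=> [[Kf /(orth_proj_ae0 CK)]|[Kf kf]].
  by move=> h; split=> //; apply: h; apply: L2_Linfty_mul => //; exact: KL2.
split=> //; apply/(orth_proj_ae0 CK) => //.
by apply: L2_Linfty_mul => //; exact: KL2.
Qed.

(** For fixed [k] the condition reads [<f, conj(g) k> = 0], and [conj(g) k] is
    in L2. *)
Lemma ker_toeplitz_closed_subspace : closed_subspace (ker_toeplitz theta g).
Proof.
have [_ K0 KD KZ _] := CK.
have Lg f : L2 f -> L2 (fun t => g t * f t) by exact: L2_Linfty_mul.
apply: adherent_closed_subspace.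
- by move=> f /ker_toeplitzP[/KL2].
- apply/ker_toeplitzP; split=> // k /KL2 Lk.
  rewrite (_ : (fun t => _) = (fun=> 0 * 0)).
    by rewrite inner_prodZl ?mul0r //; exact: L2_cst.
  by apply/funext => t; rewrite !mulr0.
- move=> f h /ker_toeplitzP[Kf kf] /ker_toeplitzP[Kh kh].
  apply/ker_toeplitzP; split=> [|k Kk]; first exact: KD.
  rewrite (_ : (fun t => _) = (fun t => g t * f t + g t * h t)).
    by rewrite inner_prodDl ?kf ?kh ?addr0 //; [exact/Lg/KL2..|exact: KL2].
  by apply/funext => t; rewrite mulrDr.
- move=> c f /ker_toeplitzP[Kf kf].
  apply/ker_toeplitzP; split=> [|k Kk]; first exact: KZ.
  rewrite (_ : (fun t => _) = (fun t => c * (g t * f t))).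
    by rewrite inner_prodZl ?kf ?mulr0 //; [exact/Lg/KL2|exact: KL2].
  by apply/funext => t; rewrite mulrCA.
- move=> f Lf fp; apply/ker_toeplitzP; split=> [|k Kk].
    apply: closed_subspace_adherent CK Lf _ => e /fp.
    by move=> [h /ker_toeplitzP[Kh _] hf]; exists h.
  have Lk := KL2 Kk.
  pose gk t := (g t * (k t)^*%C)^*%C.
  have Lgk : L2 gk by apply: L2_conj; apply: Lg; exact: L2_conj.
  have gkE h : inner_prod (fun t => g t * h t) k = inner_prod h gk.
    rewrite /inner_prod; congr circle_int; apply/funext => t.
    by rewrite /gk conjcK; ring.
  apply/sqnorm_eq0/eqP; rewrite eq_le sqnorm_ge0 andbT leNgt; apply/negP => pos.
  have gk0 := nrm2_ge0 gk.
  have e0 : 0 < sqnorm (inner_prod (fun t => g t * f t) k) / (nrm2 gk + 1).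
    by rewrite divr_gt0 // ltr_wpDl.
  have [h /ker_toeplitzP[/KL2 Lh hk] hf] := fp _ e0.
  move: hf; apply/negP; rewrite -leNgt ler_pdivrMr ?ltr_wpDl //.
  have -> : inner_prod (fun t => g t * f t) k = inner_prod (fun t => f t - h t) gk.
    by rewrite gkE inner_prodBl // -(gkE h) hk // subr0.
  apply: le_trans (cauchy_schwarz (L2B Lf Lh) Lgk) _.
  by rewrite nrm2_distC // ler_wpM2l ?nrm2_ge0 // lerDl.
Qed.

(** Testing [g z^n f] on the element of [model_space_unshift] for [f0] shows that
    the left-hand side is the integral of [g z^n f f0 conj(theta)], which is
    symmetric in [f] and [f0]. *)
Lemma ker_pairing_symmetry n f f0 : H2 f -> H2 f0 ->
  ker_toeplitz theta g (fun t => eit t ^+ n * f t) ->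
  ker_toeplitz theta g (fun t => eit t ^+ n * f0 t) ->
  circle_int f0 * inner_prod (fun t => g t * (eit t ^+ n * f t)) theta =
  circle_int f * inner_prod (fun t => g t * (eit t ^+ n * f0 t)) theta.
Proof.
suff E u v : H2 u -> H2 v -> ker_toeplitz theta g (fun t => eit t ^+ n * u t) ->
    ker_toeplitz theta g (fun t => eit t ^+ n * v t) ->
    circle_int v * inner_prod (fun t => g t * (eit t ^+ n * u t)) theta =
    circle_int (fun t => g t * eit t ^+ n * u t * v t * (theta t)^*%C).
  move=> Hf Hf0 kf kf0; rewrite !E //; congr circle_int.
  by apply/funext => t; ring.
move=> Hu Hv /ker_toeplitzP[Ku uK] /ker_toeplitzP[Kv _].
have Lgu : L2 (fun t => g t * (eit t ^+ n * u t)).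
  by apply: L2_Linfty_mul => //; exact: KL2.
have Lt := H2_L2 Ht.
have := uK _ (model_space_unshift mtheta theta1 Kv Ht Hv).
have Ltv : L2 (theta_flip theta v) by apply: L2_theta_flip => //; exact: H2_L2.
rewrite inner_prodBr // ?inner_prodZr ?conjcK //; last exact: L2Z.
move=> /eqP; rewrite subr_eq0 => /eqP <-; rewrite /inner_prod; congr circle_int.
by apply/funext => t; rewrite /theta_flip conjM conjcK; ring.
Qed.

(** [f0] forces [g z^n f] to be orthogonal to [theta], hence to all of [z K]
    where [K] is the model space, because [z K] is contained in [K] up to
    multiples of [theta]. *)
Lemma ker_toeplitz_shift n f f0 : H2 f -> circle_int f = 0 ->
  H2 f0 -> circle_int f0 <> 0 ->
  ker_toeplitz theta g (fun t => eit t ^+ n * f t) ->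
  ker_toeplitz theta g (fun t => eit t ^+ n * f0 t) ->
  ker_toeplitz theta g (fun t => eit t ^+ n * (f t / eit t)).
Proof.
move=> Hf fm Hf0 f0m kf kf0.
have gt0 : inner_prod (fun t => g t * (eit t ^+ n * f t)) theta = 0.
  have := ker_pairing_symmetry Hf Hf0 kf kf0; rewrite fm mul0r => /eqP.
  by rewrite mulf_eq0 => /orP[/eqP|/eqP].
have Hfz : H2 (fun t => f t / eit t) by exact: H2_div_eit.
move: kf => /ker_toeplitzP[Kf fK]; apply/ker_toeplitzP; split.
  apply/model_spaceP => //; split; first exact: H2_eitX_mul.
  have /model_spaceP[//|//|_ [Hfl _]] := Kf.
  rewrite (_ : theta_flip _ _ =
      (fun t => eit t * theta_flip theta (fun t => eit t ^+ n * f t) t)).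
    by split; [exact: H2_eit_mul|exact: circle_int_eit_mul].
  apply/funext => t; rewrite /theta_flip !conjM eitV conjcK; ring.
move=> k Kk; have Lk := KL2 Kk.
have [c Kc] := model_space_eit_mul mtheta theta1 Ht Kk.
have := fK _ Kc.
have Lgf : L2 (fun t => g t * (eit t ^+ n * f t)).
  by apply: L2_Linfty_mul => //; exact: KL2.
have Lt := H2_L2 Ht.
rewrite inner_prodBr //; [|exact: L2_eit_mul|exact: L2Z].
rewrite inner_prodZr // gt0 mulr0 subr0 => <-.
rewrite /inner_prod; congr circle_int; apply/funext => t.
by rewrite conjM eitV; ring.
Qed.

End Kernel.

Lemma zpow_H2P n f : zpow_H2 n f <->
  exists2 h, H2 h & L2 f /\ {ae m, forall t, f t = eit t ^+ n * h t}.
Proof.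
by split=> [[Lf [h Hh fh]]|[h Hh [Lf fh]]]; [exists h|split=> //; exists h].
Qed.

Lemma div_zpowP (M : set circle_fun) n f : closed_subspace M ->
  div_zpow M n f <-> L2 f /\ M (fun t => eit t ^+ n * f t).
Proof.
move=> CM; split=> [[Lf [h Mh fh]]|[Lf Mf]].
  split=> //; apply: (closed_subspace_ae CM Mh); first exact: L2_eitX_mul.
  apply: ae_imply fh => t ->.
  by rewrite mulrA mulfV ?mul1r // expf_neq0 // eit_neq0.
split=> //; exists (fun t => eit t ^+ n * f t) => //; apply: ae_all => t.
by rewrite mulrA mulVf ?mul1r // expf_neq0 // eit_neq0.
Qed.

Lemma div_zpow_closed_subspace (M : set circle_fun) n : closed_subspace M ->
  closed_subspace (div_zpow M n).
Proof.
move=> CM; have [_ M0 MD MZ _] := CM; apply: adherent_closed_subspace.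
- by move=> f [].
- apply/div_zpowP => //; split; first exact: L2_cst.
  by rewrite (_ : (fun t => _) = (fun=> 0)) //; apply/funext => t; rewrite mulr0.
- move=> f h /(div_zpowP _ _ CM)[Lf Mf] /(div_zpowP _ _ CM)[Lh Mh].
  apply/div_zpowP => //; split; first exact: L2D.
  have := MD _ _ Mf Mh; congr (M _).
  by apply/funext => t; rewrite mulrDr.
- move=> c f /(div_zpowP _ _ CM)[Lf Mf].
  apply/div_zpowP => //; split; first exact: L2Z.
  have := MZ c _ Mf; congr (M _).
  by apply/funext => t; rewrite mulrCA.
- move=> f Lf fp; apply/div_zpowP => //; split=> //.
  apply: (closed_subspace_adherent CM (L2_eitX_mul n Lf)) => e /fp.
  move=> [k /(div_zpowP _ _ CM)[Lk Mk] kf]; exists (fun t => eit t ^+ n * k t) => //.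
  rewrite (_ : (fun t => _) = (fun t => eit t ^+ n * (k t - f t))).
    by rewrite nrm2_eitX_mul.
  by apply/funext => t; rewrite mulrBr.
Qed.

End Circle.

Theorem theorem4p3 (R : realType) (theta g : R -> R[i]) (n : nat) :
  inner_function theta ->
  Linfty g ->
  ker_toeplitz theta g `<=` zpow_H2 n ->
  (forall k : nat, ker_toeplitz theta g `<=` zpow_H2 k -> (k <= n)%N) ->
  nearly_Sstar_invariant (div_zpow (ker_toeplitz theta g) n).
Proof.
move=> [Ht _ theta1] Bg kerz nmax.
have Cker := ker_toeplitz_closed_subspace Ht theta1 Bg.
have [kerL2 _ _ _ _] := Cker.
have CH2 := H2_closed_subspace R.
have unz h h' : L2 h -> H2 h' ->
    {ae circle_measure R, forall t, eit t ^+ n * h t = eit t ^+ n * h' t} -> H2 h.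
  move=> Lh Hh' hh'; apply: (closed_subspace_ae CH2 Hh' Lh).
  by apply: ae_imply hh' => t /mulfI ->; rewrite // expf_neq0 // eit_neq0.
have divH2 f : div_zpow (ker_toeplitz theta g) n f -> H2 f.
  move=> /(div_zpowP _ _ Cker)[Lf /kerz/zpow_H2P[h Hh [_ fh]]].
  exact: unz Lf Hh fh.
split=> //; first exact: div_zpow_closed_subspace.
(* If every such f0 had mean zero, it could be divided by z once more, and the
   kernel would be contained in z^(n+1) H2. *)
have [f0 [Hf0 f0m kf0]] : exists f0, [/\ H2 f0, circle_int f0 <> 0 &
    ker_toeplitz theta g (fun t => eit t ^+ n * f0 t)].
  apply: contrapT => none.
  suff /nmax : ker_toeplitz theta g `<=` zpow_H2 n.+1 by rewrite ltnn.
  move=> h kh; have Lh := kerL2 _ kh.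
  have /zpow_H2P[f0 Hf0 [_ hf0]] := kerz _ kh.
  have kf0 : ker_toeplitz theta g (fun t => eit t ^+ n * f0 t).
    by apply: closed_subspace_ae Cker kh _ hf0; exact/L2_eitX_mul/H2_L2.
  have f0m : circle_int f0 = 0.
    by apply: contrapT => f0m; apply: none; exists f0.
  apply/zpow_H2P; exists (fun t => f0 t / eit t); first exact: H2_div_eit.
  split=> //; apply: ae_imply hf0 => t ->.
  by rewrite exprS; field; exact: eit_neq0.
move=> f Mf; have Hf := divH2 _ Mf.
rewrite disc_ext0 // => fm.
move: Mf => /(div_zpowP _ _ Cker)[Lf kf].
rewrite (_ : backward_shift f = (fun t => f t / eit t)); last first.
  by apply/funext => t; rewrite /backward_shift disc_ext0 // fm subr0.
apply/div_zpowP => //; split; first exact: L2_div_eit.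
exact: ker_toeplitz_shift fm Hf0 f0m kf kf0.
Qed.
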